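(* Let $K$ be a field, let $m \geq 2$ be an integer, and assume that $K$ contains a primitive $m$-th root of unity $q$. Let $k, l, n$ be positive integers with $k^l \equiv 1 \pmod n$, and let $D_{ln}^k = \langle c, d \mid c^l = 1,\ d^n = 1,\ cd = d^k c\rangle$. (1) There exists a bijection between the set of all matched pairs of Hopf algebras $(T_{m^2}(q), K[D_{ln}^k], \triangleleft, \triangleright)$ and the set $U_l(K) \times U_{(n,\,k-1)}(K)$ such that the matched pair $(\triangleleft, \triangleright)$ corresponding to $(\beta, \sigma) \in U_l(K) \times U_{(n,\,k-1)}(K)$ is given by $$d^t c^i \triangleright h^{j'} x^j = \beta^{ij}\, \sigma^{tj}\, h^{j'} x^j, \qquad d^t c^i \triangleleft h^{j'} x^j = d^t c^i\, \varepsilon(h^{j'} x^j)$$ for all $t = 0, \dots, n-1$, $i = 0, \dots, l-1$ and $j, j' = 0, \dots, m-1$. (2) Any bicrossed product between $T_{m^2}(q)$ and $K[D_{ln}^k]$ (that is, any $T_{m^2}(q) \bowtie K[D_{ln}^k]$ associated to such a matched pair) is isomorphic as a Hopf algebra to $T_{lnm^2}^{\beta,\sigma}(q)$ for some $(\beta, \sigma) \in U_l(K) \times U_{(n,\,k-1)}(K)$, where $T_{lnm^2}^{\beta,\sigma}(q)$ is the Hopf algebra generated as an algebra by $c, d, h, x$ subject to the relations $$c^l = d^n = h^m = 1, \quad x^m = 0, \quad ch = hc, \quad dh = hd, \quad cd = d^k c,$$ $$cx = \beta\, xc, \quad dx = \sigma\, xd, \quad xh = q\, hx,$$ with coalgebra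 structure and antipode given by $$\Delta(c) = c \otimes c, \quad \Delta(d) = d \otimes d, \quad \Delta(h) = h \otimes h, \quad \Delta(x) = x \otimes h + 1 \otimes x,$$ $$\varepsilon(c) = \varepsilon(d) = \varepsilon(h) = 1, \quad \varepsilon(x) = 0,$$ $$S(h) = h^{m-1}, \quad S(x) = -x h^{m-1}, \quad S(c) = c^{l-1}, \quad S(d) = d^{n-1}.$$
   Context: All algebras, coalgebras, Hopf algebras and tensor products are over $K$. Sweedler notation $\Delta(y) = y_{(1)} \otimes y_{(2)}$ is used (summation understood). For a positive integer $r$, $U_r(K)$ is the group of $r$-th roots of unity in $K$; a primitive $m$-th root of unity is a generator of $U_m(K)$ when $|U_m(K)| = m$. $(a,b)$ denotes the greatest common divisor (so $(n,0) = n$). $K[G]$ denotes the group Hopf algebra of a group $G$. The group $D_{ln}^k$ is a semidirect product of the cyclic groups $C_n = \langle d\rangle$ and $C_l = \langle c \rangle$; its elements are uniquely $d^t c^i$ with $0 \leq t \leq n-1$, $0 \leq i \leq l-1$. Taft algebra: $T_{m^2}(q)$ is the Hopf algebra generated as an algebra by $h$ and $x$ subject to $h^m = 1$, $x^m = 0$, $xh = q\,hx$, with $\Delta(h) = h \otimes h$, $\Delta(x) = x \otimes h + 1 \otimes x$, $\varepsilon(h) = 1$, $\varepsilon(x) = 0$. The elements $h^i x^j$, $0 \leq i, j \leq m-1$, form a $K$-basis. Matched pair of Hopf algebras: a quadruple $(A, H, \triangleleft, \triangleright)$ where $A$, $H$ are Hopf algebras and $\triangleleft : H \otimes A \to H$,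 $\triangleright : H \otimes A \to A$ are linear maps such that $(A, \triangleright)$ is a left $H$-module coalgebra, $(H, \triangleleft)$ is a right $A$-module coalgebra, and for all $a, b \in A$, $y, z \in H$: $$y \triangleright 1_A = \varepsilon_H(y) 1_A, \qquad 1_H \triangleleft a = \varepsilon_A(a) 1_H,$$ $$y \triangleright (ab) = (y_{(1)} \triangleright a_{(1)}) \bigl( (y_{(2)} \triangleleft a_{(2)}) \triangleright b \bigr),$$ $$(yz) \triangleleft a = \bigl( y \triangleleft (z_{(1)} \triangleright a_{(1)}) \bigr) (z_{(2)} \triangleleft a_{(2)}),$$ $$y_{(1)} \triangleleft a_{(1)} \otimes y_{(2)} \triangleright a_{(2)} = y_{(2)} \triangleleft a_{(2)} \otimes y_{(1)} \triangleright a_{(1)}.$$ Bicrossed product: the Hopf algebra $A \bowtie H$ associated to a matched pair is the tensor coalgebra $A \otimes H$ (with $a \otimes y$ written $a \bowtie y$) with unit $1_A \bowtie 1_H$, multiplication $(a \bowtie y)(b \bowtie z) = a\,(y_{(1)} \triangleright b_{(1)}) \bowtie (y_{(2)} \triangleleft b_{(2)})\, z$ and antipode $S(a \bowtie y) = S_H(y_{(2)}) \triangleright S_A(a_{(2)}) \bowtie S_H(y_{(1)}) \triangleleft S_A(a_{(1)})$. *)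

(* Defs.v *)
From HB Require Import structures.
From mathcomp Require Import all_boot all_order all_algebra all_fingroup all_field.
From mathcomp Require Import finmap.
From mathcomp.multinomials Require Import monalg.

Set Implicit Arguments.
Unset Strict Implicit.
Unset Printing Implicit Defensive.

Import GRing.Theory.

Local Open Scope ring_scope.

Reserved Notation "u \ox v" (at level 40, left associativity).
Reserved Notation "\tsum_ ( a , b <- t ) E"
  (at level 41, E at level 41, a name, b name,
   format "'[' \tsum_ ( a ,  b  <-  t ) '/  '  E ']'").

(* All spaces below are finite dimensional, so U (x) V is modelled by the
   matrices of coordinates on the products of the basis vectors of U and V. *)
Definition tensor (K : fieldType) (U V : vectType K) : vectType K :=
  'M[K]_(\dim {:U}, \dim {:V}).

Notation "U \ox V" := (tensor U V) : type_scope.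

Section Tensor.
Context {K : fieldType} {U V : vectType K}.

Definition tens (u : U) (v : V) : (U \ox V)%type := 
  \matrix_(i, j) (coord (vbasis {:U}) i u * coord (vbasis {:V}) j v).

(* For f bilinear, tlift f is the linear map with tlift f (u (x) v) = f u v
   (lemma tlift_tens); it is used to write sums in Sweedler notation. *)
Definition tlift {W : vectType K} (f : U -> V -> W) (t : (U \ox V)%type) : W :=
  \sum_i \sum_j
    (t : 'M_(_, _)) i j *: f (vbasis {:U})`_i (vbasis {:V})`_j.

End Tensor.

Notation "u \ox v" := (tens u v) : ring_scope.
Notation "\tsum_ ( a , b <- t ) E" := (tlift (fun a b => E) t) : ring_scope.

Section TensorTheory.
Context {K : fieldType} {U V W : vectType K}.

Lemma tlift_is_linear (f : U -> V -> W) : linear (tlift f).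
Proof.
move=> a s t; rewrite /tlift scaler_sumr -big_split; apply: eq_bigr => i _ /=.
rewrite scaler_sumr -big_split; apply: eq_bigr => j _ /=.
by rewrite !mxE scalerDl scalerA.
Qed.

HB.instance Definition _ f :=
  GRing.isLinear.Build K (U \ox V)%type W *:%R (tlift f) (tlift_is_linear f).

Lemma tensDl (u u' : U) (v : V) : (u + u') \ox v = u \ox v + u' \ox v.
Proof. by apply/matrixP=> i j; rewrite !mxE linearD mulrDl. Qed.

Lemma tensDr (u : U) (v v' : V) : u \ox (v + v') = u \ox v + u \ox v'.
Proof. by apply/matrixP=> i j; rewrite !mxE linearD mulrDr. Qed.

Lemma tensZl a (u : U) (v : V) : (a *: u) \ox v = a *: (u \ox v).
Proof. by apply/matrixP=> i j; rewrite !mxE linearZ mulrA. Qed.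

Lemma tensZr a (u : U) (v : V) : u \ox (a *: v) = a *: (u \ox v).
Proof. by apply/matrixP=> i j; rewrite !mxE linearZ /= mulrCA. Qed.

Lemma tlift_tens (f : U -> V -> W) u v :
    (forall v, linear (f^~ v)) -> (forall u, linear (f u)) ->
  \tsum_(a, b <- u \ox v) f a b = f u v.
Proof.
move=> fl fr.
pose Fl v := HB.pack_for {linear U -> W} (f^~ v)
  (GRing.isLinear.Build K U W *:%R (f^~ v) (fl v)).
pose Fr u := HB.pack_for {linear V -> W} (f u)
  (GRing.isLinear.Build K V W *:%R (f u) (fr u)).
rewrite {2}(coord_vbasis (memvf u)) -[RHS]/(Fl v _) linear_sum.
apply: eq_bigr => i _; rewrite linearZ /= -[f _ v]/(Fr _ v).
rewrite {2}(coord_vbasis (memvf v)) linear_sum scaler_sumr.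
by apply: eq_bigr => j _; rewrite linearZ scalerA !mxE.
Qed.

Lemma eq_tlift (f g : U -> V -> W) : f =2 g -> tlift f =1 tlift g.
Proof.
by move=> fg t; apply: eq_bigr => i _; apply: eq_bigr => j _; rewrite fg.
Qed.

Lemma tlift_funP a (f g : U -> V -> W) t :
  \tsum_(u, v <- t) (a *: f u v + g u v) = a *: tlift f t + tlift g t.
Proof.
rewrite /tlift scaler_sumr -big_split; apply: eq_bigr => i _ /=.
rewrite scaler_sumr -big_split; apply: eq_bigr => j _ /=.
by rewrite scalerDr !scalerA mulrC.
Qed.

End TensorTheory.

HB.mixin Record Vector_isCoalgebra (K : fieldType) C of Vector K C := {
  comul : {linear C -> (C \ox C)%type};
  counit : {scalar C};
  comulA : forall y : C,
    \tsum_(y1, y2 <- comul y) \tsum_(y11, y12 <- comul y1)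
      (y11 \ox (y12 \ox y2)) =
    \tsum_(y1, y2 <- comul y) (y1 \ox comul y2);
  counitl : forall y : C, \tsum_(y1, y2 <- comul y) counit y1 *: y2 = y;
  counitr : forall y : C, \tsum_(y1, y2 <- comul y) counit y2 *: y1 = y
}.

#[short(type="coalgType")]
HB.structure Definition Coalgebra (K : fieldType) :=
  { C of Vector_isCoalgebra K C & Vector K C }.

Section TensorAlgebra.
Context {K : fieldType} {A B : falgType K}.

Definition tmul (s t : (A \ox B)%type) : (A \ox B)%type :=
  \tsum_(a, b <- s) \tsum_(a', b' <- t) ((a * a') \ox (b * b')).

End TensorAlgebra.

HB.mixin Record FalgCoalg_isHopfAlgebra (K : fieldType) A
    of Falgebra K A & Coalgebra K A := {
  antipode : {linear A -> A};
  comul1 : comul (1 : A) = 1 \ox 1;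
  comulM : forall a b : A, comul (a * b) = tmul (comul a) (comul b);
  counit1 : counit (1 : A) = 1;
  counitM : forall a b : A, counit (a * b) = counit a * counit b;
  antipodel : forall a : A,
    \tsum_(a1, a2 <- comul a) (antipode a1 * a2) = counit a *: 1;
  antipoder : forall a : A,
    \tsum_(a1, a2 <- comul a) (a1 * antipode a2) = counit a *: 1
}.

#[short(type="hopfAlgType")]
HB.structure Definition HopfAlgebra (K : fieldType) :=
  { A of FalgCoalg_isHopfAlgebra K A & Falgebra K A & Coalgebra K A }.

Section MatchedPair.
Context {K : fieldType} (A H : hopfAlgType K).

(* is_left_module_coalgebra and is_right_module_coalgebra unfold "module whose
   structure map is a morphism of coalgebras". *)
Definition is_left_module_coalgebra (lact : 'Hom((H \ox A)%type, A)) : Prop :=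
  [/\ forall a : A, lact (1 \ox a) = a,
      forall (y z : H) (a : A), lact ((y * z) \ox a) = lact (y \ox lact (z \ox a)),
      forall (y : H) (a : A), comul (lact (y \ox a)) =
        \tsum_(y1, y2 <- comul y) \tsum_(a1, a2 <- comul a)
          (lact (y1 \ox a1) \ox lact (y2 \ox a2))
    & forall (y : H) (a : A), counit (lact (y \ox a)) = counit y * counit a].

Definition is_right_module_coalgebra (ract : 'Hom((H \ox A)%type, H)) : Prop :=
  [/\ forall y : H, ract (y \ox 1) = y,
      forall (y : H) (a b : A), ract (y \ox (a * b)) = ract (ract (y \ox a) \ox b),
      forall (y : H) (a : A), comul (ract (y \ox a)) =
        \tsum_(y1, y2 <- comul y) \tsum_(a1, a2 <- comul a)
          (ract (y1 \ox a1) \ox ract (y2 \ox a2))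
    & forall (y : H) (a : A), counit (ract (y \ox a)) = counit y * counit a].

Record matchedPair := MatchedPair {
  mp_ract : 'Hom((H \ox A)%type, H);
  mp_lact : 'Hom((H \ox A)%type, A);
  mp_lmodcoalg : is_left_module_coalgebra mp_lact;
  mp_rmodcoalg : is_right_module_coalgebra mp_ract;
  mp_lact1 : forall y : H, mp_lact (y \ox 1) = counit y *: 1;
  mp_ract1 : forall a : A, mp_ract (1 \ox a) = counit a *: 1;
  mp_lactM : forall (y : H) (a b : A),
    mp_lact (y \ox (a * b)) =
    \tsum_(y1, y2 <- comul y) \tsum_(a1, a2 <- comul a)
      (mp_lact (y1 \ox a1) * mp_lact (mp_ract (y2 \ox a2) \ox b));
  mp_ractM : forall (y z : H) (a : A),
    mp_ract ((y * z) \ox a) =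
    \tsum_(z1, z2 <- comul z) \tsum_(a1, a2 <- comul a)
      (mp_ract (y \ox mp_lact (z1 \ox a1)) * mp_ract (z2 \ox a2));
  mp_swap : forall (y : H) (a : A),
    \tsum_(y1, y2 <- comul y) \tsum_(a1, a2 <- comul a)
      (mp_ract (y1 \ox a1) \ox mp_lact (y2 \ox a2)) =
    \tsum_(y1, y2 <- comul y) \tsum_(a1, a2 <- comul a)
      (mp_ract (y2 \ox a2) \ox mp_lact (y1 \ox a1))
}.

End MatchedPair.

Notation "y '<|[' mp ] a" := (mp_ract mp (y \ox a))
  (at level 40, format "y  '<|[' mp ]  a") : ring_scope.
Notation "y '|>[' mp ] a" := (mp_lact mp (y \ox a))
  (at level 40, format "y  '|>[' mp ]  a") : ring_scope.

Record hopfData (K : fieldType) (V : vectType K) := HopfData {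
  hd_mul : V -> V -> V;
  hd_one : V;
  hd_comul : V -> (V \ox V)%type;
  hd_counit : V -> K;
  hd_antipode : V -> V
}.

Definition hopf_data (K : fieldType) (A : hopfAlgType K) : hopfData A :=
  HopfData *%R 1 comul counit antipode.

Definition hopf_isomorphic (K : fieldType) (V W : vectType K)
    (DV : hopfData V) (DW : hopfData W) : Prop :=
  exists f : {linear V -> W},
    bijective f /\
    [/\ f (hd_one DV) = hd_one DW,
        forall u v, f (hd_mul DV u v) = hd_mul DW (f u) (f v),
        forall u, \tsum_(u1, u2 <- hd_comul DV u) (f u1 \ox f u2) =
                  hd_comul DW (f u),
        forall u, hd_counit DV u = hd_counit DW (f u)
      & forall u, f (hd_antipode DV u) = hd_antipode DW (f u)].

(* The operations of the bicrossed product; an isomorphism with (hopf_data of)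
   a Hopf algebra entails that they satisfy the Hopf algebra axioms. *)
Definition bicrossed (K : fieldType) (A H : hopfAlgType K)
    (mp : matchedPair A H) : hopfData (A \ox H)%type :=
  HopfData
    (fun s t => \tsum_(a, y <- s) \tsum_(b, z <- t)
       \tsum_(y1, y2 <- comul y) \tsum_(b1, b2 <- comul b)
         ((a * (y1 |>[mp] b1)) \ox ((y2 <|[mp] b2) * z)))
    (1 \ox 1)
    (fun s => \tsum_(a, y <- s)
       \tsum_(a1, a2 <- comul a) \tsum_(y1, y2 <- comul y)
         ((a1 \ox y1) \ox (a2 \ox y2)))
    (tlift (W := K^o) (fun a y => counit a * counit y))
    (fun s => \tsum_(a, y <- s)
       \tsum_(a1, a2 <- comul a) \tsum_(y1, y2 <- comul y)
         ((antipode y2 |>[mp] antipode a2) \ox (antipode y1 <|[mp] antipode a1))).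

Definition groupAlg (K : fieldType) (gT : finGroupType) : Type :=
  {ffun gT -> K}.

Section GroupAlgebra.
Context {K : fieldType} {gT : finGroupType}.
Local Notation KG := (groupAlg K gT).

HB.instance Definition _ := Vector.copy KG {ffun gT -> K^o}.

Implicit Types (f : KG) (g : gT).

Definition gelt g : KG := [ffun z => (z == g)%:R].

Definition galg_mul (f1 f2 : KG) : KG :=
  [ffun z => \sum_g f1 g * f2 (g^-1 * z)%g].

Lemma galgE f : f = \sum_g f g *: gelt g.
Proof.
apply/ffunP=> z; rewrite sum_ffunE (bigD1 z) //= big1 => [|g zg].
  by rewrite addr0 !ffunE eqxx [RHS]mulr1.
by rewrite !ffunE eq_sym (negPf zg); apply: mulr0.
Qed.

Lemma galg_mulA : associative galg_mul.
Proof.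
move=> f1 f2 f3; apply/ffunP=> z; rewrite !ffunE.
under eq_bigr do rewrite ffunE mulr_sumr.
under [RHS]eq_bigr do rewrite ffunE mulr_suml.
rewrite [RHS]exchange_big /=; apply: eq_bigr => g _.
rewrite [RHS](reindex_inj (mulgI g)) /=; apply: eq_bigr => g' _.
by rewrite mulKg invMg !mulgA mulrA.
Qed.

Lemma galg_mul1l : left_id (gelt 1%g) galg_mul.
Proof.
move=> f; apply/ffunP=> z; rewrite !ffunE (bigD1 1%g) //= big1 => [|g /negPf zg].
  by rewrite ffunE eqxx mul1r invg1 mul1g addr0.
by rewrite ffunE zg mul0r.
Qed.

Lemma galg_mul1r : right_id (gelt 1%g) galg_mul.
Proof.
move=> f; apply/ffunP=> z; rewrite !ffunE (bigD1 z) //= big1 => [|g /negPf zg].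
  by rewrite ffunE mulVg eqxx mulr1 addr0.
by rewrite ffunE -eq_mulVg1 zg mulr0.
Qed.

Lemma galg_mulDl : left_distributive galg_mul +%R.
Proof.
move=> f1 f2 f3; apply/ffunP=> z; rewrite !ffunE -big_split /=.
by apply: eq_bigr => g _; rewrite ffunE mulrDl.
Qed.

Lemma galg_mulDr : right_distributive galg_mul +%R.
Proof.
move=> f1 f2 f3; apply/ffunP=> z; rewrite !ffunE -big_split /=.
by apply: eq_bigr => g _; rewrite ffunE mulrDr.
Qed.

Lemma gelt1_neq0 : gelt 1%g != 0.
Proof.
apply/eqP=> /ffunP/(_ 1%g); rewrite !ffunE eqxx => /eqP.
by rewrite (oner_eq0 K).
Qed.

HB.instance Definition _ := GRing.Zmodule_isNzRing.Build KG
  galg_mulA galg_mul1l galg_mul1r galg_mulDl galg_mulDr gelt1_neq0.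

Lemma galg_scalerAl a f1 f2 : a *: (f1 * f2) = (a *: f1) * f2.
Proof.
apply/ffunP=> z; rewrite !ffunE [LHS]mulr_sumr.
by apply: eq_bigr => g _; rewrite ffunE mulrA.
Qed.

Lemma galg_scalerAr a f1 f2 : a *: (f1 * f2) = f1 * (a *: f2).
Proof.
apply/ffunP=> z; rewrite !ffunE [LHS]mulr_sumr.
by apply: eq_bigr => g _; rewrite ffunE [LHS]mulrCA.
Qed.

HB.instance Definition _ := GRing.Lmodule_isLalgebra.Build K KG galg_scalerAl.
HB.instance Definition _ := GRing.Lalgebra_isAlgebra.Build K KG galg_scalerAr.
HB.instance Definition _ := Algebra_isFalgebra.Build K KG.

Definition galg_ext {W : vectType K} (F : gT -> W) f : W := \sum_g f g *: F g.

Lemma galg_ext_is_linear (W : vectType K) (F : gT -> W) : linear (galg_ext F).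
Proof.
move=> a f1 f2; rewrite /galg_ext scaler_sumr -big_split /=.
by apply: eq_bigr => g _; rewrite !ffunE scalerDl scalerA.
Qed.

HB.instance Definition _ (W : vectType K) (F : gT -> W) :=
  GRing.isLinear.Build K KG W *:%R (galg_ext F) (galg_ext_is_linear F).

Lemma galg_ext_gelt (W : vectType K) (F : gT -> W) g :
  galg_ext F (gelt g) = F g.
Proof.
rewrite /galg_ext (bigD1 g) //= big1 => [|g' /negPf gg']; rewrite ffunE.
  by rewrite eqxx scale1r addr0.
by rewrite gg' scale0r.
Qed.

Lemma galg_linP (W : lmodType K) (F G : KG -> W) : linear F -> linear G ->
  (forall g, F (gelt g) = G (gelt g)) -> F =1 G.
Proof.
move=> Fl Gl FG f; rewrite (galgE f).
elim/big_rec: _ => [|g f' _ IH]; last by rewrite Fl Gl IH FG.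
by rewrite -(subrr 0) -scaleN1r addrC Fl Gl !scaleN1r !addNr.
Qed.

Lemma geltM g g' : gelt g * gelt g' = gelt (g * g')%g.
Proof.
apply/ffunP=> z; rewrite !ffunE (bigD1 g) //= big1 => [|g1 /negPf gg1].
  by rewrite !ffunE eqxx mul1r addr0 (can2_eq (mulKVg g) (mulKg g)).
by rewrite !ffunE gg1 mul0r.
Qed.

Definition galg_comul : {linear KG -> (KG \ox KG)%type} :=
  galg_ext (fun g => gelt g \ox gelt g).

Definition galg_sum f : K := \sum_g f g.

Lemma galg_sum_is_scalar : scalar galg_sum.
Proof.
move=> a f1 f2; rewrite /galg_sum mulr_sumr -big_split /=.
by apply: eq_bigr => g _; rewrite !ffunE.
Qed.

HB.instance Definition _ :=
  GRing.isLinear.Build K KG K *%R galg_sum galg_sum_is_scalar.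

Definition galg_counit : {scalar KG} := galg_sum.
Definition galg_antipode : {linear KG -> KG} :=
  galg_ext (fun g => gelt g^-1%g).

Lemma galg_comul_gelt g : galg_comul (gelt g) = gelt g \ox gelt g.
Proof. exact: galg_ext_gelt. Qed.

Lemma galg_counit_gelt g : galg_counit (gelt g) = 1.
Proof.
rewrite /= /galg_sum (bigD1 g) //= big1 => [|g' /negPf gg']; rewrite ffunE.
  by rewrite eqxx addr0.
by rewrite gg'.
Qed.

Lemma galg_antipode_gelt g : galg_antipode (gelt g) = gelt g^-1%g.
Proof. exact: galg_ext_gelt. Qed.

Lemma tlift_comul_linear (W : vectType K) (f : KG -> KG -> W) :
  linear (fun y => tlift f (galg_comul y)).
Proof. by move=> a f1 f2; rewrite !linearP. Qed.

Lemma tlift_comul_gelt (W : vectType K) (f : KG -> KG -> W) g :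
    (forall v, linear (f^~ v)) -> (forall u, linear (f u)) ->
  tlift f (galg_comul (gelt g)) = f (gelt g) (gelt g).
Proof. by move=> fl fr; rewrite galg_comul_gelt tlift_tens. Qed.

Lemma galg_comulA (y : KG) :
  \tsum_(y1, y2 <- galg_comul y) \tsum_(y11, y12 <- galg_comul y1)
    (y11 \ox (y12 \ox y2)) =
  \tsum_(y1, y2 <- galg_comul y) (y1 \ox galg_comul y2).
Proof.
move: y; apply: galg_linP => [||g]; try exact: tlift_comul_linear.
rewrite tlift_comul_gelt.
- rewrite !galg_comul_gelt !tlift_tens ?galg_comul_gelt //.
  + by move=> v a u u'; rewrite tensDl tensZl.
  + by move=> u a v v'; rewrite linearP tensDr tensZr.
  + by move=> v a u u'; rewrite tensDl tensZl.
  + by move=> u a v v'; rewrite tensDl tensDr tensZl tensZr.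
- by move=> v a u u'; rewrite !linearP.
move=> u a v v'; rewrite -tlift_funP; apply: eq_tlift => z z'.
by rewrite !tensDr !tensZr.
Qed.

Lemma galg_counitl (y : KG) :
  \tsum_(y1, y2 <- galg_comul y) galg_counit y1 *: y2 = y.
Proof.
move: y; apply: galg_linP => [||g] //; first exact: tlift_comul_linear.
rewrite tlift_comul_gelt ?galg_counit_gelt ?scale1r // => u a v w.
  by rewrite linearP scalerDl scalerA.
by rewrite scalerDr !scalerA mulrC.
Qed.

Lemma galg_counitr (y : KG) :
  \tsum_(y1, y2 <- galg_comul y) galg_counit y2 *: y1 = y.
Proof.
move: y; apply: galg_linP => [||g] //; first exact: tlift_comul_linear.
rewrite tlift_comul_gelt ?galg_counit_gelt ?scale1r // => u a v w.
  by rewrite scalerDr !scalerA mulrC.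
by rewrite linearP scalerDl scalerA.
Qed.

HB.instance Definition _ := Vector_isCoalgebra.Build K KG
  galg_comulA galg_counitl galg_counitr.

Lemma galg_comul1 : galg_comul 1 = 1 \ox 1.
Proof. exact: galg_comul_gelt. Qed.

Lemma galg_comulM f1 f2 :
  galg_comul (f1 * f2) = tmul (galg_comul f1) (galg_comul f2).
Proof.
move: f1; apply: galg_linP => [a u v|a u v|g].
- by rewrite mulrDl -scalerAl linearP.
- by rewrite /tmul !linearP.
move: f2; apply: galg_linP => [a u v|a u v|g'].
- by rewrite mulrDr -scalerAr linearP.
- by rewrite /tmul -tlift_funP; apply: eq_tlift => z z'; rewrite !linearP.
rewrite geltM /tmul tlift_comul_gelt.
- rewrite tlift_comul_gelt ?galg_comul_gelt ?geltM //.
    by move=> v a u u'; rewrite mulrDr -scalerAr tensDl tensZl.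
  by move=> v a u u'; rewrite mulrDr -scalerAr tensDr tensZr.
- move=> v a u u'; rewrite -tlift_funP; apply: eq_tlift => z z'.
  by rewrite mulrDl -scalerAl tensDl tensZl.
move=> v a u u'; rewrite -tlift_funP; apply: eq_tlift => z z'.
by rewrite mulrDl -scalerAl tensDr tensZr.
Qed.

Lemma galg_counit1 : galg_counit 1 = 1.
Proof. exact: galg_counit_gelt. Qed.

Lemma galg_counitM f1 f2 :
  galg_counit (f1 * f2) = galg_counit f1 * galg_counit f2.
Proof.
move: f1; apply: (@galg_linP K^o) => [a u v|a u v|g].
- by rewrite mulrDl -scalerAl linearP.
- by rewrite linearP mulrDl; congr (_ + _); rewrite -mulrA.
move: f2; apply: (@galg_linP K^o) => [a u v|a u v|g'].
- by rewrite mulrDr -scalerAr linearP.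
- by rewrite linearP mulrDr; congr (_ + _); apply: mulrCA.
by rewrite geltM !galg_counit_gelt mulr1.
Qed.

Lemma galg_antipodel f :
  \tsum_(f1, f2 <- galg_comul f) (galg_antipode f1 * f2) = galg_counit f *: 1.
Proof.
move: f; apply: galg_linP => [|a u v|g]; first exact: tlift_comul_linear.
  by rewrite linearP scalerDl scalerA.
rewrite tlift_comul_gelt.
- by rewrite galg_antipode_gelt galg_counit_gelt geltM mulVg scale1r.
- by move=> v a u u'; rewrite linearP mulrDl -scalerAl.
by move=> v a u u'; rewrite mulrDr -scalerAr.
Qed.

Lemma galg_antipoder f :
  \tsum_(f1, f2 <- galg_comul f) (f1 * galg_antipode f2) = galg_counit f *: 1.
Proof.
move: f; apply: galg_linP => [|a u v|g]; first exact: tlift_comul_linear.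
  by rewrite linearP scalerDl scalerA.
rewrite tlift_comul_gelt.
- by rewrite galg_antipode_gelt galg_counit_gelt geltM mulgV scale1r.
- by move=> v a u u'; rewrite mulrDl -scalerAl.
by move=> v a u u'; rewrite linearP mulrDr -scalerAr.
Qed.

HB.instance Definition _ := FalgCoalg_isHopfAlgebra.Build K KG
  galg_comul1 galg_comulM galg_counit1 galg_counitM
  galg_antipodel galg_antipoder.

End GroupAlgebra.

(* K<X_0, ..., X_(N-1)>, as the algebra of the free monoid on 'I_N. *)
Notation freeAlg K N := {malg K[{fmonom 'I_N}]}.

Definition ncvar (K : fieldType) (N : nat) (i : 'I_N) : freeAlg K N :=
  << fmu i >>.

Definition nceval (K : fieldType) (N : nat) (A : algType K) (v : N.-tuple A)
    (p : freeAlg K N) : A :=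
  \sum_(w <- msupp p) p@_w *: \prod_(i <- fmonom_val w) tnth v i.

Definition in_ideal_gen (R : pzRingType) (rels : seq R) (z : R) : Prop :=
  exists2 s : seq (R * R * R),
    {in s, forall u, u.1.2 \in rels} &
    z = \sum_(u <- s) u.1.1 * u.1.2 * u.2.

(* A is the quotient of the free algebra by the two-sided ideal generated by
   rels, the tuple v being the images of the free generators. *)
Definition is_presented (K : fieldType) (N : nat) (A : algType K)
    (v : N.-tuple A) (rels : seq (freeAlg K N)) : Prop :=
  (forall a : A, exists p, nceval v p = a) /\
  (forall p, nceval v p = 0 <-> in_ideal_gen rels p).

Definition taft_relators (K : fieldType) (m : nat) (q : K) :
    seq (freeAlg K 2) :=
  let h := ncvar K (0 : 'I_2) in let x := ncvar K (1 : 'I_2) in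
  [:: h ^+ m - 1; x ^+ m; x * h - q *: (h * x)].

Definition is_taft (K : fieldType) (m : nat) (q : K)
    (T : hopfAlgType K) (h x : T) : Prop :=
  is_presented [tuple h; x] (taft_relators m q) /\
  [/\ comul h = h \ox h, comul x = x \ox h + 1 \ox x,
      counit h = 1 & counit x = 0].

Definition Tbs_relators (K : fieldType) (m : nat) (q : K) (k l n : nat)
    (beta sigma : K) : seq (freeAlg K 4) :=
  let c := ncvar K (0 : 'I_4) in let d := ncvar K (1 : 'I_4) in
  let h := ncvar K (2 : 'I_4) in let x := ncvar K (3 : 'I_4) in
  [:: c ^+ l - 1; d ^+ n - 1; h ^+ m - 1; x ^+ m;
      c * h - h * c; d * h - h * d; c * d - d ^+ k * c;
      c * x - beta *: (x * c); d * x - sigma *: (x * d);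
      x * h - q *: (h * x)].

Definition is_Tbs (K : fieldType) (m : nat) (q : K) (k l n : nat)
    (beta sigma : K) (B : hopfAlgType K) (c d h x : B) : Prop :=
  [/\ is_presented [tuple c; d; h; x] (Tbs_relators m q k l n beta sigma),
      [/\ comul c = c \ox c, comul d = d \ox d, comul h = h \ox h
        & comul x = x \ox h + 1 \ox x],
      [/\ counit c = 1, counit d = 1, counit h = 1 & counit x = 0]
    & [/\ antipode h = h ^+ (m - 1), antipode x = - (x * h ^+ (m - 1)),
          antipode c = c ^+ (l - 1) & antipode d = d ^+ (n - 1)]].

(* gT is D_ln^k with c and d as its defining generators: gT is isomorphic to
   the presented group (which is finite), and since generators of gT satisfying
   the relations are the images of the abstract ones under an epimorphism
   between finite groups of the same order, c and d correspond to them under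
   some such isomorphism. *)
Definition is_Dlnk (k l n : nat) (gT : finGroupType) (c d : gT) : Prop :=
  [/\ [set: gT] \isog Grp (c : d : c ^+ l, d ^+ n, c * d = d ^+ k * c),
      <<[set c; d]>> = [set: gT],
      c ^+ l = 1, d ^+ n = 1 & c * d = d ^+ k * c]%g.

Definition rootsOfUnity (K : fieldType) (r : nat) : Type :=
  {z : K | r.-unity_root z}.

(* Main.v *)
(* For g in D_ln^k the action a |-> g |> a is a coalgebra automorphism of the
   Taft algebra fixing 1, so u = g |> h is grouplike and y = g |> x is skew
   primitive: Delta(y) = y (x) u + 1 (x) y. Two functionals on T, read off the
   representation h |-> diag(1, q), x |-> E_12, act on T by an automorphism N
   and a q-derivation D with N D = q D N and ker D = K[h]. As K[h] is
   cocommutative and x is not, y is not in ker D, and then N D = q D N at y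
   forces u = h. The compatibility of the two actions at (g, x), paired with
   the same functionals, gives g <| h = g and g <| x = 0. So <| is trivial,
   every g acts by an algebra automorphism, and x h = q h x yields g |> x =
   chi(g) x. Hence a matched pair is a character chi of D_ln^k, that is, a
   pair (chi(c), chi(d)) in U_l x U_(n, k-1).

   Conversely a character acts on T by Hopf automorphisms, and the bicrossed
   product is the skew group algebra of T over D_ln^k. It is presented by the
   relations of T, those of D_ln^k, and the relations g a = (g |> a) g between
   the generators. That K[D_ln^k] has the expected presentation holds because
   the d^t c^i are pairwise distinct, as a permutation representation shows. *)
Require Import Defs.
From HB Require Import structures.
From mathcomp Require Import all_boot all_order all_algebra all_fingroup all_field.
From mathcomp Require Import finmap.
From mathcomp.multinomials Require Import monalg.
From Stdlib Require Import ProofIrrelevance.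

Set Implicit Arguments.
Unset Strict Implicit.
Unset Printing Implicit Defensive.

Import GRing.Theory.
Local Open Scope ring_scope.

(** * Presented algebras *)

Lemma ord2_cases (i : 'I_2) : i = 0 \/ i = 1.
Proof. by case: i => -[|[|//]] i2; [left | right]; apply: val_inj. Qed.

Section FreeAlgebra.
Context {K : fieldType} {N : nat}.
Implicit Types (p r : freeAlg K N).

Lemma free_scalerAr a p r : a *: (p * r) = p * (a *: r).
Proof.
rewrite -[LHS]mul_malgC -[a *: r]mul_malgC mulrA [RHS]mulrA.
apply: (congr1 (fun z => z * r)).
rewrite !malgM_def fgmulUg fgmulgU; apply: eq_bigr => w _.
by rewrite mulrC mul1m mulm1.
Qed.

Lemma free_ind (P : freeAlg K N -> Prop) :
    (forall a p r, P p -> P r -> P (a *: p + r)) -> P 1 ->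
    (forall i p, P p -> P (ncvar K i * p)) ->
  forall p, P p.
Proof.
move=> PZD P1 PM p; rewrite (monalgE p).
have P0 : P 0 by have := PZD (-1) 1 1 P1 P1; rewrite scaleN1r addNr.
elim/big_rec: _ => // w r _ Pr.
have -> : << p@_w *g w >> = p@_w *: << w >> :> freeAlg K N.
  by rewrite -mul_malgC malgM_def fgmulUU mulr1 mul1m.
apply: PZD => //; rewrite -[w]fmK.
elim: (fmonom_val w) => [|i s IH]; first by rewrite -fmoneE.
suff -> : << FMonom (i :: s) >> = ncvar K i * << FMonom s >> :> freeAlg K N.
  exact: PM.
by rewrite malgM_def fgmulUU mulr1 /mul /= fmmulE fmuE.
Qed.

Context {A : algType K} (v : N.-tuple A).

Definition word_eval (w : {fmonom 'I_N}) : A :=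
  \prod_(i <- fmonom_val w) tnth v i.

Lemma word_eval_mmorphism : mmorphism word_eval.
Proof.
split=> [w1 w2|]; last by rewrite /word_eval fm1 big_nil.
by rewrite /word_eval fmM big_cat.
Qed.

HB.instance Definition _ :=
  isMultiplicative.Build {fmonom 'I_N} A word_eval word_eval_mmorphism.

Lemma nceval_mmap p : nceval v p = mmap (in_alg A) word_eval p.
Proof. by apply: eq_bigr => w _; rewrite /= -scalerAl mul1r. Qed.

Lemma nceval_is_linear : linear (nceval v).
Proof. by move=> a p r; rewrite !nceval_mmap mmapD mmapZ /= mulr_algl. Qed.

HB.instance Definition _ :=
  GRing.isLinear.Build K (freeAlg K N) A *:%R (nceval v) nceval_is_linear.

Lemma nceval_is_monoid_morphism : monoid_morphism (nceval v).
Proof.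
split; first by rewrite nceval_mmap mmap1.
move=> p r; rewrite !nceval_mmap.
apply: (@commr_mmap_is_multiplicative _ _ _ (in_alg A) word_eval _).1 => f w w'.
by rewrite /GRing.comm /= mulr_algl mulr_algr.
Qed.

HB.instance Definition _ :=
  GRing.isMonoidMorphism.Build (freeAlg K N) A (nceval v)
    nceval_is_monoid_morphism.

Lemma nceval_var i : nceval v (ncvar K i) = tnth v i.
Proof.
rewrite nceval_mmap mmapU /= scale1r mul1r.
by rewrite /word_eval fmU big_seq1.
Qed.

Lemma nceval1 : nceval v 1 = 1. Proof. exact: rmorph1. Qed.
Lemma ncevalD : {morph nceval v : p r / p + r}. Proof. exact: linearD. Qed.
Lemma ncevalB : {morph nceval v : p r / p - r}. Proof. exact: linearB. Qed.
Lemma ncevalM : {morph nceval v : p r / p * r}. Proof. exact: rmorphM. Qed.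
Lemma ncevalZ a : {morph nceval v : p / a *: p}. Proof. exact: linearZ. Qed.

(* Substitutes for rewriting with the morphism lemmas, which stalls as soon as a
   goal contains two products: unification compares them by computing. *)
Lemma eq_ncevalB p r a b :
  nceval v p = a -> nceval v r = b -> nceval v (p - r) = a - b.
Proof. by move=> <- <-; apply: ncevalB. Qed.

Lemma eq_ncevalM p r a b :
  nceval v p = a -> nceval v r = b -> nceval v (p * r) = a * b.
Proof. by move=> <- <-; apply: ncevalM. Qed.

Lemma eq_ncevalZ k p a : nceval v p = a -> nceval v (k *: p) = k *: a.
Proof. by move=> <-; apply: ncevalZ. Qed.

Lemma eq_ncevalX p a i : nceval v p = a -> nceval v (p ^+ i) = a ^+ i.
Proof. by move=> <-; apply: rmorphXn. Qed.

End FreeAlgebra.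

Lemma nceval_lrmorphism (K : fieldType) (N : nat) (A B : algType K)
    (f : {lrmorphism A -> B}) (v : N.-tuple A) (w : N.-tuple B) :
  (forall i, tnth w i = f (tnth v i)) -> forall p, nceval w p = f (nceval v p).
Proof.
move=> wv; apply: free_ind => [a p r IHp IHr||i p IH].
- by rewrite !ncevalD !ncevalZ linearP IHp IHr.
- by rewrite !nceval1 rmorph1.
- by rewrite !ncevalM !nceval_var rmorphM /= IH wv.
Qed.

(* [monalg] gives [malg] an algebra structure over commutative monoids only, and
   that instance shadows any declared for [freeAlg] itself. *)
Definition ncpoly (K : fieldType) (N : nat) : Type := freeAlg K N.

HB.instance Definition _ (K : fieldType) (N : nat) :=
  GRing.Lalgebra.on (ncpoly K N).
HB.instance Definition _ (K : fieldType) (N : nat) :=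
  GRing.Lalgebra_isAlgebra.Build K (ncpoly K N) (@free_scalerAr K N).

Section Rename.
Context {K : fieldType} {M N : nat} (f : 'I_M -> 'I_N).

Definition nc_rename : freeAlg K M -> ncpoly K N :=
  nceval [tuple (ncvar K (f i) : ncpoly K N) | i < M].

HB.instance Definition _ := GRing.LRMorphism.on nc_rename.

Lemma nc_rename_var i : nc_rename (ncvar K i) = ncvar K (f i).
Proof. by rewrite /nc_rename nceval_var tnth_mktuple. Qed.

Lemma nceval_rename (A : algType K) (v : N.-tuple A) (w : M.-tuple A) p :
  (forall i, tnth v (f i) = tnth w i) -> nceval v (nc_rename p) = nceval w p.
Proof.
move=> vw; apply/esym.
apply: (@nceval_lrmorphism K M (ncpoly K N) A (nceval v)) => i.
by rewrite tnth_mktuple -vw; apply/esym/nceval_var.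
Qed.

End Rename.

Section Ideal.
Context {R : pzRingType} (rels : seq R).
Implicit Types (p r s : R).
Local Notation I := (in_ideal_gen rels).

Lemma ideal_mem p : p \in rels -> I p.
Proof.
move=> pr; exists [:: (1, p, 1)] => [u|]; first by rewrite inE => /eqP->.
by rewrite big_seq1 /= mulr1 mul1r.
Qed.

Lemma ideal0 : I 0.
Proof. by exists [::] => //; rewrite big_nil. Qed.

Lemma idealD p r : I p -> I r -> I (p + r).
Proof.
move=> [s1 i1 ->] [s2 i2 ->]; exists (s1 ++ s2); last by rewrite big_cat.
by move=> u; rewrite mem_cat => /orP[/i1|/i2].
Qed.

Lemma idealMl s p : I p -> I (s * p).
Proof.
move=> [s1 i1 ->]; exists [seq (s * u.1.1, u.1.2, u.2) | u <- s1].
  by move=> _ /mapP[u /i1 ur ->].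
by rewrite big_map mulr_sumr; apply: eq_bigr => u _; rewrite /= !mulrA.
Qed.

Lemma idealMr s p : I p -> I (p * s).
Proof.
move=> [s1 i1 ->]; exists [seq (u.1.1, u.1.2, u.2 * s) | u <- s1].
  by move=> _ /mapP[u /i1 ur ->].
by rewrite big_map mulr_suml; apply: eq_bigr => u _; rewrite /= !mulrA.
Qed.

Lemma idealN p : I p -> I (- p).
Proof. by rewrite -mulN1r; apply: idealMl. Qed.

Lemma ideal_rmorph_sub (S : pzRingType) (rels' : seq S)
    (f : {rmorphism R -> S}) :
    {in rels, forall p, in_ideal_gen rels' (f p)} ->
  forall p, I p -> in_ideal_gen rels' (f p).
Proof.
move=> fr _ [s sr ->]; rewrite rmorph_sum; elim: s sr => [|u s IH] sr.
  by rewrite big_nil; exists [::] => //; rewrite big_nil.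
rewrite big_cons; have [|s1 i1 ->] := IH.
  by move=> z zs; apply/sr/mem_behead.
have /fr[s2 i2 E] := sr _ (mem_head _ _).
exists ([seq (f u.1.1 * z.1.1, z.1.2, z.2 * f u.2) | z <- s2] ++ s1).
  by move=> z; rewrite mem_cat => /orP[/mapP[y /i2 yr ->]|/i1].
rewrite !rmorphM /= E big_cat big_map mulr_sumr mulr_suml /=; congr (_ + _).
by apply: eq_bigr => z _; rewrite !mulrA.
Qed.

Lemma ideal_rmorph0 (S : pzRingType) (f : {rmorphism R -> S}) :
  {in rels, forall p, f p = 0} -> forall p, I p -> f p = 0.
Proof.
move=> f0 _ [s sr ->]; rewrite rmorph_sum big_seq big1 // => u /sr /f0 u0.
by rewrite !rmorphM /= u0 mulr0 mul0r.
Qed.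

Definition eqmod p r : Prop := I (p - r).

Lemma eqmod_refl p : eqmod p p.
Proof. by rewrite /eqmod subrr; apply: ideal0. Qed.

Lemma eqmod_sym p r : eqmod p r -> eqmod r p.
Proof. by move/idealN; rewrite opprB. Qed.

Lemma eqmod_trans p r s : eqmod p r -> eqmod r s -> eqmod p s.
Proof. by move=> /idealD pr /pr; rewrite addrA subrK. Qed.

Lemma eqmodD p r p' r' : eqmod p r -> eqmod p' r' -> eqmod (p + p') (r + r').
Proof. by move=> /idealD pr /pr; rewrite addrACA -opprD. Qed.

Lemma eqmod_sum (J : Type) (t : seq J) (F G : J -> R) :
    (forall j, eqmod (F j) (G j)) ->
  eqmod (\sum_(j <- t) F j) (\sum_(j <- t) G j).
Proof.
move=> FG; elim/big_ind2: _ => // [|p p' r r' pp' rr'].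
  exact: eqmod_refl.
exact: eqmodD.
Qed.

Lemma eqmodMl s p r : eqmod p r -> eqmod (s * p) (s * r).
Proof. by move/(idealMl s); rewrite mulrBr. Qed.

Lemma eqmodMr s p r : eqmod p r -> eqmod (p * s) (r * s).
Proof. by move/(idealMr s); rewrite mulrBl. Qed.

Lemma eqmod_exp_modn p e i : eqmod (p ^+ e) 1 -> eqmod (p ^+ i) (p ^+ (i %% e)).
Proof.
move=> pe; rewrite {1}(divn_eq i e) exprD mulnC exprM.
rewrite -[X in eqmod _ X]mul1r; apply: eqmodMr.
elim: (i %/ e)%N => [|b IH]; first exact: eqmod_refl.
by rewrite exprS; apply: eqmod_trans (eqmodMr _ pe) _; rewrite mul1r.
Qed.

End Ideal.

Lemma eqmodZ (K : pzRingType) (R : lalgType K) (rels : seq R) a p r :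
  eqmod rels p r -> eqmod rels (a *: p) (a *: r).
Proof. by move/(eqmodMl (a%:A)); rewrite !mulr_algl. Qed.

Section Presented.
Context {K : fieldType} {N : nat} {A : algType K} {v : N.-tuple A}.
Context {rels : seq (freeAlg K N)}.

Lemma eq_presented rels' : rels =i rels' ->
  is_presented v rels -> is_presented v rels'.
Proof.
move=> rr' [surj ker]; split=> // p; rewrite ker.
by split=> -[s sr ->]; exists s => // u /sr; rewrite rr'.
Qed.

Lemma presented_of_section (s : {linear A -> freeAlg K N}) :
    {in rels, forall p, nceval v p = 0} -> cancel s (nceval v) ->
    eqmod rels (s 1) 1 ->
    (forall i a, eqmod rels (ncvar K i * s a) (s (tnth v i * a))) ->
  is_presented v rels.
Proof.
move=> rels0 sK s1 sM.
have section_nceval : forall p, eqmod rels p (s (nceval v p)).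
  apply: free_ind => [a p r IHp IHr||i p IH].
  - by rewrite !linearP; apply: eqmodD => //; apply: eqmodZ.
  - by rewrite nceval1; apply: eqmod_sym.
  - rewrite ncevalM nceval_var.
    exact: eqmod_trans (eqmodMl _ IH) (sM _ _).
split=> [a|p]; first by exists (s a).
split=> [p0|]; last exact: ideal_rmorph0.
by have := section_nceval p; rewrite p0 linear0 /eqmod subr0.
Qed.

Hypothesis vP : is_presented v rels.

Lemma presented_rel p : p \in rels -> nceval v p = 0.
Proof. by move=> pr; apply/vP.2/ideal_mem. Qed.

Lemma presented_eqmod p r : nceval v p = nceval v r -> eqmod rels p r.
Proof. by move=> pr; apply/vP.2; rewrite ncevalB pr subrr. Qed.

Lemma presented_ind (P : A -> Prop) :
    (forall a u w, P u -> P w -> P (a *: u + w)) -> P 1 ->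
    (forall i u, P u -> P (tnth v i * u)) ->
  forall u, P u.
Proof.
move=> PZD P1 PM u; have [p <-] := vP.1 u.
move: p; apply: free_ind => [a p r Pp Pr||i p Pp].
- by rewrite linearP; apply: PZD.
- by rewrite nceval1.
- by rewrite ncevalM nceval_var; apply: PM.
Qed.

Lemma nceval_surj u : exists p, nceval v p == u.
Proof. by have [p <-] := vP.1 u; exists p. Qed.

Lemma presented_lift (B : algType K) (w : N.-tuple B) :
    {in rels, forall p, nceval w p = 0} ->
  {f : {lrmorphism A -> B} | forall i, f (tnth v i) = tnth w i}.
Proof.
move=> w0; pose f u := nceval w (xchoose (nceval_surj u)).
have fE p : f (nceval v p) = nceval w p.
  apply/eqP; rewrite -subr_eq0 -ncevalB; apply/eqP/(ideal_rmorph0 w0).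
  exact/presented_eqmod/eqP/(xchooseP (nceval_surj _)).
have f_linear : linear f.
  move=> a u1 u2; have [p1 <-] := vP.1 u1; have [p2 <-] := vP.1 u2.
  by rewrite -linearP !fE linearP.
have f_monoid : monoid_morphism f.
  split=> [|u1 u2]; first by rewrite -(nceval1 v) fE nceval1.
  have [p1 <-] := vP.1 u1; have [p2 <-] := vP.1 u2.
  by rewrite -ncevalM !fE ncevalM.
exists (HB.pack_for {lrmorphism A -> B} f
  (GRing.isLinear.Build K A B *:%R f f_linear)
  (GRing.isMonoidMorphism.Build A B f f_monoid)) => i /=.
by rewrite -nceval_var fE nceval_var.
Qed.

Lemma presented_lrmorphism_ext (B : algType K) (f g : {lrmorphism A -> B}) :
  (forall i, f (tnth v i) = g (tnth v i)) -> f =1 g.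
Proof.
move=> fg; apply: presented_ind => [a u w IHu IHw||i u IH].
- by rewrite !linearP /= IHu IHw.
- by rewrite !rmorph1.
- by rewrite !rmorphM /= fg IH.
Qed.

End Presented.

Lemma presented_section (K : fieldType) (N : nat) (A : falgType K)
    (v : N.-tuple A) (rels : seq (freeAlg K N)) (vP : is_presented v rels) :
  {s : {linear A -> freeAlg K N} | cancel s (nceval v)}.
Proof.
pose s u : freeAlg K N := \sum_i coord (vbasis {:A}) i u *:
  xchoose (nceval_surj vP (vbasis {:A})`_i).
have s_linear : linear s.
  move=> a u w; rewrite /s scaler_sumr -big_split; apply: eq_bigr => i _ /=.
  by rewrite linearP scalerDl scalerA.
exists (HB.pack_for {linear A -> freeAlg K N} s
  (GRing.isLinear.Build K A (freeAlg K N) *:%R s s_linear)) => u /=.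
rewrite [RHS](coord_vbasis (memvf u)) linear_sum; apply: eq_bigr => i _.
by rewrite linearZ; congr (_ *: _); apply/eqP/(xchooseP (nceval_surj vP _)).
Qed.

(** * Tensors and Hopf algebras *)

Section Multilinear.
Context {K : fieldType}.

Lemma lin_id (U : lmodType K) : linear (fun u : U => u).
Proof. by []. Qed.

Lemma lin_comp (U V W : lmodType K) (L : {linear V -> W}) (f : U -> V) :
  linear f -> linear (fun u => L (f u)).
Proof. by move=> fl a u v; rewrite fl linearP. Qed.

Lemma lin_tensl (U : lmodType K) (V W : vectType K) (f : U -> V) (w : W) :
  linear f -> linear (fun u => f u \ox w).
Proof. by move=> fl a u v; rewrite fl tensDl tensZl. Qed.

Lemma lin_tensr (U : lmodType K) (V W : vectType K) (f : U -> V) (w : W) :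
  linear f -> linear (fun u => w \ox f u).
Proof. by move=> fl a u v; rewrite fl tensDr tensZr. Qed.

Lemma lin_mull (U : lmodType K) (A : algType K) (f : U -> A) (w : A) :
  linear f -> linear (fun u => f u * w).
Proof. by move=> fl a u v; rewrite fl mulrDl scalerAl. Qed.

Lemma lin_mulr (U : lmodType K) (A : algType K) (f : U -> A) (w : A) :
  linear f -> linear (fun u => w * f u).
Proof. by move=> fl a u v; rewrite fl mulrDr scalerAr. Qed.

Lemma lin_scalel (U V : lmodType K) (f : U -> K) (w : V) :
  scalar f -> linear (fun u => f u *: w).
Proof. by move=> fl a u v; rewrite fl scalerDl scalerA. Qed.

Lemma lin_scaler (U V : lmodType K) (f : U -> V) b :
  linear f -> linear (fun u => b *: f u).
Proof. by move=> fl a u v; rewrite fl scalerDr !scalerA mulrC. Qed.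

Lemma lin_tlift (U : lmodType K) (V W Y : vectType K) (F : U -> V -> W -> Y) t :
    (forall v w, linear (fun u => F u v w)) ->
  linear (fun u => \tsum_(v, w <- t) F u v w).
Proof.
by move=> Fl a u u'; rewrite -tlift_funP; apply: eq_tlift => v w; apply: Fl.
Qed.

Lemma lin_galg_ext (gT : finGroupType) (U : lmodType K) (W : vectType K)
    (F : U -> gT -> W) (y : groupAlg K gT) :
  (forall g, linear (F^~ g)) -> linear (fun u => galg_ext (F u) y).
Proof.
move=> Fl a u v; rewrite /galg_ext scaler_sumr -big_split /=.
by apply: eq_bigr => g _; rewrite Fl scalerDr !scalerA mulrC.
Qed.

Lemma lin_scalar (U V : lmodType K) (L : {scalar V}) (f : U -> V) :
  linear f -> scalar (fun u => L (f u)).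
Proof. by move=> fl a u v; rewrite fl linearP. Qed.

Lemma scalar_mull (U : lmodType K) (f : U -> K) b :
  scalar f -> scalar (fun u => f u * b).
Proof. by move=> fl a u v; rewrite fl mulrDl mulrA. Qed.

Lemma scalar_mulr (U : lmodType K) (f : U -> K) b :
  scalar f -> scalar (fun u => b * f u).
Proof. by move=> fl a u v; rewrite fl mulrDr mulrCA. Qed.

End Multilinear.

Ltac lin_step :=
  cbv beta;
  first [ assumption
        | apply: lin_id
        | apply: lin_tensl | apply: lin_tensr
        | apply: lin_mull | apply: lin_mulr
        | apply: lin_scalel | apply: lin_scaler
        | apply: lin_tlift | apply: lin_galg_ext | apply: lin_comp
        | apply: lin_scalar | apply: scalar_mull | apply: scalar_mulr ].

Ltac lin := repeat (intros; lin_step).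

Section TensorSums.
Context {K : fieldType}.
Implicit Types (U V W : vectType K).

Lemma tens0l U V (v : V) : (0 : U) \ox v = 0.
Proof. by rewrite -(scale0r 0) tensZl scale0r. Qed.

Lemma tlift_linear U V W W' (L : W -> W') (f : U -> V -> W) t : linear L ->
  L (tlift f t) = \tsum_(a, b <- t) L (f a b).
Proof.
move=> Ll; pose L' := HB.pack_for {linear W -> W'} L
  (GRing.isLinear.Build K W W' *:%R L Ll).
rewrite -[L]/(L' : _ -> _) linear_sum; apply: eq_bigr => i _.
rewrite linear_sum.
by apply: eq_bigr => j _; rewrite linearZ.
Qed.

Lemma tlift_tsum U V U' V' W (f : U' -> V' -> W) (F : U -> V -> U')
    (G : U -> V -> V') t :
    (forall v, linear (f^~ v)) -> (forall u, linear (f u)) ->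
  tlift f (\tsum_(a, b <- t) (F a b \ox G a b)) =
  \tsum_(a, b <- t) f (F a b) (G a b).
Proof.
move=> fl fr; rewrite tlift_linear; last by lin.
by apply: eq_tlift => a b; rewrite tlift_tens.
Qed.

Lemma tlift_id U V (t : (U \ox V)%type) : \tsum_(a, b <- t) (a \ox b) = t.
Proof.
have tens_basis (i : 'I_(\dim {:U})) (j : 'I_(\dim {:V})) :
    (vbasis {:U})`_i \ox (vbasis {:V})`_j = delta_mx i j :> 'M[K]_(_, _).
  apply/matrixP => i' j'.
  rewrite !mxE !coord_free ?(basis_free (vbasisP _)) // -natrM mulnb.
  by rewrite [i == _]eq_sym [j == _]eq_sym.
rewrite [RHS]matrix_sum_delta /tlift.
by under eq_bigr do under eq_bigr do rewrite tens_basis.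
Qed.

Lemma tens_linP U V W (F G : (U \ox V)%type -> W) : linear F -> linear G ->
  (forall u v, F (u \ox v) = G (u \ox v)) -> F =1 G.
Proof.
move=> Fl Gl FG t; rewrite -[t]tlift_id !tlift_linear //.
exact: eq_tlift.
Qed.

Lemma tlift_tmul (A B : falgType K) W (f : A -> B -> W) s t :
    (forall v, linear (f^~ v)) -> (forall u, linear (f u)) ->
  tlift f (tmul s t) =
  \tsum_(a, b <- s) \tsum_(a', b' <- t) f (a * a') (b * b').
Proof.
move=> fl fr; rewrite tlift_linear; last by lin.
by apply: eq_tlift => a b; rewrite tlift_tsum.
Qed.

Lemma tlift_prod U V U' V' (A : falgType K) (F : U -> V -> A)
    (G : U' -> V' -> A) s t :
  \tsum_(a, b <- s) \tsum_(a', b' <- t) (F a b * G a' b') =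
  tlift F s * tlift G t.
Proof.
rewrite -[RHS]/((fun u => u * tlift G t) (tlift F s)) tlift_linear; last by lin.
apply: eq_tlift => a b; rewrite -[RHS]/((fun u => F a b * u) (tlift G t)).
by rewrite tlift_linear //; lin.
Qed.

Lemma tmul_map (A B A' B' : falgType K) (f : {lrmorphism A -> A'})
    (g : {lrmorphism B -> B'}) s t :
  \tsum_(a, b <- tmul s t) (f a \ox g b) =
  tmul (\tsum_(a, b <- s) (f a \ox g b)) (\tsum_(a, b <- t) (f a \ox g b)).
Proof.
rewrite tlift_tmul; try by lin.
rewrite /tmul tlift_tsum; try by lin.
apply: eq_tlift => a b; rewrite tlift_tsum; try by lin.
by apply: eq_tlift => a' b'; rewrite !rmorphM.
Qed.

End TensorSums.

Section Coalgebra.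
Context {K : fieldType} {C : coalgType K}.

Lemma tlift_counitl (W : vectType K) (L : C -> W) (y : C) : linear L ->
  \tsum_(y1, y2 <- comul y) counit y1 *: L y2 = L y.
Proof.
move=> Ll; rewrite -[in RHS](counitl y) tlift_linear //.
by apply: eq_tlift => y1 y2; rewrite (GRing.scalable_linear Ll).
Qed.

Lemma tlift_counitr (W : vectType K) (L : C -> W) (y : C) : linear L ->
  \tsum_(y1, y2 <- comul y) counit y2 *: L y1 = L y.
Proof.
move=> Ll; rewrite -[in RHS](counitr y) tlift_linear //.
by apply: eq_tlift => y1 y2; rewrite (GRing.scalable_linear Ll).
Qed.

(* The right action u <- f of a functional f of the dual algebra. *)
Definition hit (f : {scalar C}) (u : C) : C :=
  \tsum_(u1, u2 <- comul u) f u1 *: u2.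

Lemma hit_is_linear f : linear (hit f).
Proof. by rewrite /hit; lin. Qed.

HB.instance Definition _ f :=
  GRing.isLinear.Build K C C *:%R (hit f) (hit_is_linear f).

Definition grouplike (u : C) : Prop := comul u = u \ox u /\ counit u = 1.

Lemma hit_grouplike f u : grouplike u -> hit f u = f u *: u.
Proof. by case=> cu _; rewrite /hit cu tlift_tens //; lin. Qed.

Definition cocommutes (u : C) : Prop :=
  \tsum_(u1, u2 <- comul u) (u2 \ox u1) = comul u.

End Coalgebra.

Section CoalgebraMorphism.
Context {K : fieldType} {C C' : coalgType K}.

Definition coalg_morph (F : C -> C') : Prop :=
  [/\ linear F,
      forall a, comul (F a) = \tsum_(a1, a2 <- comul a) (F a1 \ox F a2)
    & forall a, counit (F a) = counit a].

Lemma grouplike_map (F : C -> C') u :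
  coalg_morph F -> grouplike u -> grouplike (F u).
Proof.
by move=> [Fl cF eF] [cu eu]; split; rewrite ?eF // cF cu tlift_tens //; lin.
Qed.

Lemma cocommutes_map (F : C -> C') u :
  coalg_morph F -> cocommutes u -> cocommutes (F u).
Proof.
move=> [Fl cF _] cu; rewrite /cocommutes cF tlift_tsum; try by lin.
by rewrite -[in RHS]cu tlift_tsum //; lin.
Qed.

End CoalgebraMorphism.

Section HopfAlgebra.
Context {K : fieldType} {H : hopfAlgType K}.
Implicit Types u v x : H.

Lemma counitX u i : counit (u ^+ i) = counit u ^+ i.
Proof. by elim: i => [|i IH]; rewrite ?counit1 // !exprS counitM IH. Qed.

Lemma grouplike1 : grouplike (1 : H).
Proof. by split; [exact: comul1 | exact: counit1]. Qed.

Lemma grouplikeX u i : grouplike u -> grouplike (u ^+ i).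
Proof.
move=> [cu eu]; elim: i => [|i [cui eui]]; first exact: grouplike1.
split; rewrite exprS ?counitM ?eu ?eui ?mulr1 // comulM cu cui /tmul.
by rewrite !tlift_tens //; lin.
Qed.

Lemma antipode_grouplike u v : grouplike u -> u * v = 1 -> antipode u = v.
Proof.
move=> [cu eu] uv; have := antipodel u; rewrite cu tlift_tens; try by lin.
by rewrite eu scale1r => Su; rewrite -[LHS]mulr1 -uv mulrA Su mul1r.
Qed.

Lemma antipode1 : antipode (1 : H) = 1.
Proof. by apply: antipode_grouplike; [exact: grouplike1 | rewrite mulr1]. Qed.

Definition skew_primitive u x : Prop := comul x = x \ox u + 1 \ox x.

Lemma hit_skew_primitive (f : {scalar H}) u x :
  skew_primitive u x -> hit f x = f x *: u + f 1 *: x.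
Proof. by move=> cx; rewrite /hit cx linearD /= !tlift_tens //; lin. Qed.

Lemma counit_skew_primitive u x :
  grouplike u -> skew_primitive u x -> counit x = 0.
Proof.
move=> [_ eu] cx; have := counitr x; rewrite cx linearD /=.
rewrite !tlift_tens; try by lin.
rewrite eu scale1r -[RHS]addr0 => /addrI/(congr1 counit).
by rewrite linearZ linear0 /= counit1 mulr1.
Qed.

Lemma antipode_skew_primitive u v x :
  grouplike u -> skew_primitive u x -> u * v = 1 -> antipode x = - (x * v).
Proof.
move=> gu cx uv; have := antipodel x; rewrite cx linearD /=.
rewrite !tlift_tens; try by lin.
rewrite (counit_skew_primitive gu cx) scale0r antipode1 mul1r => /eqP.
rewrite addr_eq0 => /eqP Sx.
by rewrite -mulNr -Sx -mulrA uv mulr1.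
Qed.

Lemma counit_antipode u : counit (antipode u) = counit u.
Proof.
have <- : counit (\tsum_(a1, a2 <- comul u) (antipode a1 * a2) : H) = counit u.
  by rewrite antipodel linearZ /= counit1; apply: mulr1.
rewrite (@tlift_linear _ _ _ _ K^o counit); last first.
  by move=> a v w; rewrite linearP.
rewrite -(@tlift_counitr _ _ K^o (fun a => counit (antipode a))); last by lin.
by apply: (@eq_tlift _ _ _ K^o) => a1 a2; rewrite counitM [RHS]mulrC.
Qed.

Lemma hit1 (f : {scalar H}) : hit f 1 = f 1 *: 1.
Proof. exact/hit_grouplike/grouplike1. Qed.

Lemma hitM (f : {scalar H}) u v : (forall a b, f (a * b) = f a * f b) ->
  hit f (u * v) = hit f u * hit f v.
Proof.
move=> fM; rewrite /hit comulM tlift_tmul; try by lin.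
rewrite -tlift_prod; apply: eq_tlift => a b; apply: eq_tlift => a' b'.
by rewrite fM -scalerAl -scalerAr scalerA.
Qed.

Lemma hit_skew_derivation (f g : {scalar H}) u v :
    (forall a b, f (a * b) = counit a * f b + f a * g b) ->
  hit f (u * v) = u * hit f v + hit f u * hit g v.
Proof.
move=> fM; rewrite -{2}[u]counitl /hit comulM tlift_tmul; try by lin.
rewrite -!tlift_prod -[LHS]scale1r -[X in _ = X + _]scale1r -tlift_funP scale1r.
apply: eq_tlift => a b; rewrite -tlift_funP; apply: eq_tlift => a' b'.
by rewrite fM scale1r scalerDl -!scalerAl -!scalerAr !scalerA.
Qed.

End HopfAlgebra.

Lemma skew_primitive_map (K : fieldType) (H H' : hopfAlgType K)
    (F : H -> H') u x :
  coalg_morph F -> F 1 = 1 -> skew_primitive u x -> skew_primitive (F u) (F x).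
Proof.
move=> [Fl cF _] F1 cx; rewrite /skew_primitive cF cx linearD /=.
by rewrite !tlift_tens ?F1 //; lin.
Qed.

Lemma presented_coalg_morph (K : fieldType) (N : nat) (A B : hopfAlgType K)
    (v : N.-tuple A) (rels : seq (freeAlg K N)) (f : {lrmorphism A -> B}) :
    is_presented v rels ->
    (forall i, comul (f (tnth v i)) =
       \tsum_(a1, a2 <- comul (tnth v i)) (f a1 \ox f a2)) ->
    (forall i, counit (f (tnth v i)) = counit (tnth v i)) ->
  coalg_morph f.
Proof.
move=> vP comul_f counit_f; split; first by lin.
- apply: (presented_ind vP) => [b u w IHu IHw||i u IH].
  + by rewrite !linearP IHu IHw.
  + by rewrite (rmorph1 f) comul1 (@comul1 K A) tlift_tens ?(rmorph1 f) //; lin.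
  + by rewrite (comulM (tnth v i) u) tmul_map -comul_f -IH -comulM -(rmorphM f).
- apply: (presented_ind vP) => [b u w IHu IHw||i u IH].
  + by rewrite !linearP IHu IHw.
  + by rewrite (rmorph1 f) !counit1.
  + by rewrite (rmorphM f) !counitM counit_f IH.
Qed.

(** * Skew group Hopf algebras *)

Record hopfAction (K : fieldType) (gT : finGroupType) (T : hopfAlgType K) :=
  HopfAction {
  hact :> gT -> {lrmorphism T -> T};
  hact1 : forall a, hact 1%g a = a;
  hactM : forall g g' a, hact (g * g')%g a = hact g (hact g' a);
  hact_coalg : forall g, coalg_morph (hact g)
}.

Definition skewGroupAlg (K : fieldType) (gT : finGroupType)
  (T : hopfAlgType K) (phi : hopfAction gT T) : Type := {ffun gT -> T}.

Section SkewGroupAlgebra.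
Context {K : fieldType} {gT : finGroupType} {T : hopfAlgType K}.
Context {phi : hopfAction gT T}.
Local Notation B := (skewGroupAlg phi).
Implicit Types (f : B) (g : gT) (a : T).

HB.instance Definition _ := Vector.copy B {ffun gT -> T}.

Definition single g a : B := [ffun z => if z == g then a else 0].

Lemma single_is_linear g : linear (single g).
Proof.
move=> b a a'; apply/ffunP=> z; rewrite !ffunE.
by case: eqP; rewrite ?scaler0 ?addr0.
Qed.

HB.instance Definition _ g :=
  GRing.isLinear.Build K T B *:%R (single g) (single_is_linear g).

Lemma skewE f : f = \sum_g single g (f g).
Proof.
apply/ffunP=> z; rewrite sum_ffunE (bigD1 z) //= big1 => [|g /negPf zg].
  by rewrite addr0 ffunE eqxx.
by rewrite ffunE eq_sym zg.
Qed.

Definition skew_ext {W : lmodType K} (F : gT -> {linear T -> W}) f : W :=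
  \sum_g F g (f g).

Lemma skew_ext_is_linear (W : lmodType K) (F : gT -> {linear T -> W}) :
  linear (skew_ext F).
Proof.
move=> b f1 f2; rewrite /skew_ext scaler_sumr -big_split /=.
by apply: eq_bigr => g _; rewrite !ffunE linearP.
Qed.

HB.instance Definition _ (W : lmodType K) (F : gT -> {linear T -> W}) :=
  GRing.isLinear.Build K B W *:%R (skew_ext F) (skew_ext_is_linear F).

Lemma skew_ext_single (W : lmodType K) (F : gT -> {linear T -> W}) g a :
  skew_ext F (single g a) = F g a.
Proof.
rewrite /skew_ext (bigD1 g) //= big1 => [|g' /negPf gg']; rewrite ffunE.
  by rewrite eqxx addr0.
by rewrite gg' linear0.
Qed.

Lemma skew_linP (W : lmodType K) (F G : B -> W) : linear F -> linear G ->
  (forall g a, F (single g a) = G (single g a)) -> F =1 G.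
Proof.
move=> Fl Gl FG f; rewrite (skewE f).
elim/big_rec: _ => [|g f' _ IH]; last first.
  by rewrite -[single g _]scale1r Fl Gl IH FG.
by rewrite -(subrr 0) -scaleN1r addrC Fl Gl !scaleN1r !addNr.
Qed.

Lemma skew_scalarP (F G : B -> K) : scalar F -> scalar G ->
  (forall g a, F (single g a) = G (single g a)) -> F =1 G.
Proof. exact: (@skew_linP K^o). Qed.

Definition skew_mul f1 f2 : B :=
  [ffun z => \sum_g f1 g * phi g (f2 (g^-1 * z)%g)].

Lemma skew_mulA : associative skew_mul.
Proof.
move=> f1 f2 f3; apply/ffunP=> z; rewrite !ffunE.
under eq_bigr do rewrite ffunE linear_sum mulr_sumr.
under [RHS]eq_bigr do rewrite ffunE mulr_suml.
rewrite [RHS]exchange_big /=; apply: eq_bigr => g _.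
rewrite [RHS](reindex_inj (mulgI g)) /=; apply: eq_bigr => g' _.
by rewrite mulKg invMg !mulgA (rmorphM (phi _)) hactM mulrA.
Qed.

Lemma skew_mul1l : left_id (single 1%g 1) skew_mul.
Proof.
move=> f; apply/ffunP=> z.
rewrite !ffunE (bigD1 1%g) //= big1 => [|g /negPf zg].
  by rewrite ffunE eqxx mul1r invg1 mul1g hact1 addr0.
by rewrite ffunE zg mul0r.
Qed.

Lemma skew_mul1r : right_id (single 1%g 1) skew_mul.
Proof.
move=> f; apply/ffunP=> z; rewrite !ffunE (bigD1 z) //= big1 => [|g /negPf zg].
  by rewrite ffunE mulVg eqxx (rmorph1 (phi _)) mulr1 addr0.
by rewrite ffunE -eq_mulVg1 zg linear0 mulr0.
Qed.

Lemma skew_mulDl : left_distributive skew_mul +%R.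
Proof.
move=> f1 f2 f3; apply/ffunP=> z; rewrite !ffunE -big_split /=.
by apply: eq_bigr => g _; rewrite ffunE mulrDl.
Qed.

Lemma skew_mulDr : right_distributive skew_mul +%R.
Proof.
move=> f1 f2 f3; apply/ffunP=> z; rewrite !ffunE -big_split /=.
by apply: eq_bigr => g _; rewrite ffunE linearD mulrDr.
Qed.

Lemma skew_one_neq0 : single 1%g 1 != 0.
Proof.
by apply/eqP=> /ffunP/(_ 1%g); rewrite !ffunE eqxx => /eqP; rewrite oner_eq0.
Qed.

HB.instance Definition _ := GRing.Zmodule_isNzRing.Build B
  skew_mulA skew_mul1l skew_mul1r skew_mulDl skew_mulDr skew_one_neq0.

Lemma skew_scalerAl b f1 f2 : b *: (f1 * f2) = (b *: f1) * f2.
Proof.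
apply/ffunP=> z; rewrite !ffunE scaler_sumr.
by apply: eq_bigr => g _; rewrite ffunE scalerAl.
Qed.

Lemma skew_scalerAr b f1 f2 : b *: (f1 * f2) = f1 * (b *: f2).
Proof.
apply/ffunP=> z; rewrite !ffunE scaler_sumr.
by apply: eq_bigr => g _; rewrite ffunE linearZ /= scalerAr.
Qed.

HB.instance Definition _ := GRing.Lmodule_isLalgebra.Build K B skew_scalerAl.
HB.instance Definition _ := GRing.Lalgebra_isAlgebra.Build K B skew_scalerAr.
HB.instance Definition _ := Algebra_isFalgebra.Build K B.

Lemma singleM g g' a a' :
  single g a * single g' a' = single (g * g')%g (a * phi g a').
Proof.
apply/ffunP=> z; rewrite !ffunE (bigD1 g) //= big1 => [|g1 /negPf gg1].
  rewrite !ffunE eqxx addr0 (can2_eq (mulKVg g) (mulKg g)).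
  by case: eqP; rewrite ?linear0 ?mulr0.
by rewrite !ffunE gg1 mul0r.
Qed.

Lemma skew1E : 1 = single 1%g 1 :> B.
Proof. by []. Qed.

Definition skew_comul : {linear B -> (B \ox B)%type} :=
  skew_ext (fun g =>
    [the {linear T -> _} of
      tlift (fun a1 a2 => single g a1 \ox single g a2) \o comul]).

Definition skew_sum f : K := \sum_g counit (f g).

Lemma skew_sum_is_scalar : scalar skew_sum.
Proof.
move=> b f1 f2; rewrite /skew_sum mulr_sumr -big_split /=.
by apply: eq_bigr => g _; rewrite !ffunE linearP.
Qed.

HB.instance Definition _ :=
  GRing.isLinear.Build K B K *%R skew_sum skew_sum_is_scalar.

Definition skew_counit : {scalar B} := skew_sum.

Definition skew_antipode : {linear B -> B} :=
  skew_ext (fun g =>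
    [the {linear T -> B} of single g^-1%g \o phi g^-1%g \o antipode]).

Lemma skew_comul_single g a : skew_comul (single g a) =
  \tsum_(a1, a2 <- comul a) (single g a1 \ox single g a2).
Proof. exact: skew_ext_single. Qed.

Lemma skew_counit_single g a : skew_counit (single g a) = counit a.
Proof.
rewrite /= /skew_sum (bigD1 g) //= big1 => [|g' /negPf gg']; rewrite ffunE.
  by rewrite eqxx addr0.
by rewrite gg' linear0.
Qed.

Lemma skew_antipode_single g a :
  skew_antipode (single g a) = single g^-1%g (phi g^-1%g (antipode a)).
Proof. exact: skew_ext_single. Qed.

Lemma tlift_skew_comul (W : vectType K) (F : B -> B -> W) g a :
    (forall v, linear (F^~ v)) -> (forall u, linear (F u)) ->
  tlift F (skew_comul (single g a)) =
  \tsum_(a1, a2 <- comul a) F (single g a1) (single g a2).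
Proof. by move=> Fl Fr; rewrite skew_comul_single tlift_tsum. Qed.

Lemma skew_comulA f :
  \tsum_(y1, y2 <- skew_comul f) \tsum_(y11, y12 <- skew_comul y1)
    (y11 \ox (y12 \ox y2)) =
  \tsum_(y1, y2 <- skew_comul f) (y1 \ox skew_comul y2).
Proof.
move: f; apply: skew_linP => [||g a]; [by lin | by lin |].
rewrite !tlift_skew_comul; try by lin.
pose L (a1 : T) (t : (T \ox T)%type) : (B \ox (B \ox B))%type :=
  single g a1 \ox (\tsum_(a2, a3 <- t) (single g a2 \ox single g a3)).
transitivity (tlift L (\tsum_(a1, a2 <- comul a) (a1 \ox comul a2))).
  rewrite -comulA tlift_linear; last by rewrite /L; lin.
  apply: eq_tlift => a1 a2; rewrite tlift_skew_comul; try by lin.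
  rewrite tlift_tsum /L; try by lin.
  by apply: eq_tlift => a3 a4; rewrite tlift_tens //; lin.
rewrite tlift_tsum /L; try by lin.
by apply: eq_tlift => a1 a2; rewrite skew_comul_single.
Qed.

Lemma skew_counitl f :
  \tsum_(y1, y2 <- skew_comul f) skew_counit y1 *: y2 = f.
Proof.
move: f; apply: skew_linP => [||g a]; [by lin | by [] |].
rewrite tlift_skew_comul; try by lin.
rewrite -(tlift_counitl (L := single g)); last by lin.
by apply: eq_tlift => a1 a2; rewrite skew_counit_single.
Qed.

Lemma skew_counitr f :
  \tsum_(y1, y2 <- skew_comul f) skew_counit y2 *: y1 = f.
Proof.
move: f; apply: skew_linP => [||g a]; [by lin | by [] |].
rewrite tlift_skew_comul; try by lin.
rewrite -(tlift_counitr (L := single g)); last by lin.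
by apply: eq_tlift => a1 a2; rewrite skew_counit_single.
Qed.

HB.instance Definition _ := Vector_isCoalgebra.Build K B
  skew_comulA skew_counitl skew_counitr.

Lemma skew_comul1 : skew_comul 1 = 1 \ox 1.
Proof. by rewrite skew1E skew_comul_single comul1 tlift_tens //; lin. Qed.

Lemma hact_comul g a : comul (phi g a) =
  \tsum_(a1, a2 <- comul a) (phi g a1 \ox phi g a2).
Proof. by case: (hact_coalg phi g). Qed.

Lemma hact_counit g a : counit (phi g a) = counit a.
Proof. by case: (hact_coalg phi g). Qed.

Lemma skew_comulM f1 f2 :
  skew_comul (f1 * f2) = tmul (skew_comul f1) (skew_comul f2).
Proof.
move: f1; apply: skew_linP => [||g a]; [by lin | by lin |].
move: f2; apply: skew_linP => [||g' a']; [by lin | by lin |].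
rewrite singleM skew_comul_single comulM tlift_tmul; try by lin.
rewrite /tmul tlift_skew_comul; try by lin.
apply: eq_tlift => a1 a2; rewrite hact_comul tlift_tsum; try by lin.
rewrite tlift_skew_comul; try by lin.
by apply: eq_tlift => a1' a2'; rewrite !singleM.
Qed.

Lemma skew_counit1 : skew_counit 1 = 1.
Proof. by rewrite skew1E skew_counit_single counit1. Qed.

Lemma skew_counitM f1 f2 :
  skew_counit (f1 * f2) = skew_counit f1 * skew_counit f2.
Proof.
move: f1; apply: skew_scalarP => [||g a]; [by lin | by lin |].
move: f2; apply: skew_scalarP => [||g' a']; [by lin | by lin |].
by rewrite singleM !skew_counit_single counitM hact_counit.
Qed.

Lemma skew_antipodel f :
  \tsum_(f1, f2 <- skew_comul f) (skew_antipode f1 * f2) = skew_counit f *: 1.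
Proof.
move: f; apply: skew_linP => [||g a]; [by lin | by lin |].
rewrite tlift_skew_comul; try by lin.
pose L (b : T) : B := single 1%g (phi g^-1%g b).
transitivity (L (counit a *: 1)).
  rewrite -antipodel tlift_linear; last by rewrite /L; lin.
  apply: eq_tlift => a1 a2.
  by rewrite skew_antipode_single singleM mulVg -(rmorphM (phi _)).
by rewrite /L linearZ (rmorph1 (phi _)) linearZ skew_counit_single.
Qed.

Lemma skew_antipoder f :
  \tsum_(f1, f2 <- skew_comul f) (f1 * skew_antipode f2) = skew_counit f *: 1.
Proof.
move: f; apply: skew_linP => [||g a]; [by lin | by lin |].
rewrite tlift_skew_comul; try by lin.
transitivity (single 1%g (counit a *: 1) : B).
  rewrite -antipoder tlift_linear; last by lin.
  apply: eq_tlift => a1 a2.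
  by rewrite skew_antipode_single singleM mulgV -hactM mulgV hact1.
by rewrite linearZ skew_counit_single.
Qed.

HB.instance Definition _ := FalgCoalg_isHopfAlgebra.Build K B
  skew_comul1 skew_comulM skew_counit1 skew_counitM
  skew_antipodel skew_antipoder.

End SkewGroupAlgebra.

(** * Matched pairs from group actions *)

Section GroupAlgebra.
Context {K : fieldType} {gT : finGroupType}.
Local Notation KG := (groupAlg K gT).
Implicit Types g : gT.

Lemma comul_gelt g : comul (gelt g : KG) = gelt g \ox gelt g.
Proof. exact: galg_comul_gelt. Qed.

Lemma counit_gelt g : counit (gelt g : KG) = 1.
Proof. exact: galg_counit_gelt. Qed.

Lemma antipode_gelt g : antipode (gelt g : KG) = gelt g^-1%g.
Proof. exact: galg_antipode_gelt. Qed.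

Lemma galg_scalarP (F G : KG -> K) : scalar F -> scalar G ->
  (forall g, F (gelt g) = G (gelt g)) -> F =1 G.
Proof. exact: (@galg_linP K gT K^o). Qed.

Lemma tens_galg_linP (U W : vectType K) (F G : (U \ox KG)%type -> W) :
    linear F -> linear G ->
  (forall u g, F (u \ox gelt g) = G (u \ox gelt g)) -> F =1 G.
Proof.
move=> Fl Gl FG; apply: tens_linP => // u.
apply: galg_linP => // a y y'; rewrite tensDr tensZr; [exact: Fl | exact: Gl].
Qed.

Lemma galg_tens_linP (U W : vectType K) (F G : (KG \ox U)%type -> W) :
    linear F -> linear G ->
  (forall g u, F (gelt g \ox u) = G (gelt g \ox u)) -> F =1 G.
Proof.
move=> Fl Gl FG; apply: tens_linP => // y u; move: y.
apply: galg_linP => // a y y'; rewrite tensDl tensZl; [exact: Fl | exact: Gl].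
Qed.

Lemma matchedPair_eq (T : hopfAlgType K) (mp mp' : matchedPair T KG) :
    (forall g a, gelt g |>[mp] a = gelt g |>[mp'] a) ->
    (forall g a, gelt g <|[mp] a = gelt g <|[mp'] a) ->
  mp = mp'.
Proof.
have ext (W : vectType K) (f f' : 'Hom((KG \ox T)%type, W)) :
    (forall g a, f (gelt g \ox a) = f' (gelt g \ox a)) -> f = f'.
  by move=> ff'; apply/lfunP; apply: galg_tens_linP => //; lin.
move=> /ext + /ext.
case: mp mp' => r s ? ? ? ? ? ? ? [r' s' ? ? ? ? ? ? ?] /= lactE ractE.
by subst r' s'; congr MatchedPair; apply: proof_irrelevance.
Qed.

Section GroupLikeActions.
Context {T : hopfAlgType K} (mp : matchedPair T KG).
Implicit Types a b : T.

Lemma mp_lact_gelt1 g : gelt g |>[mp] 1 = 1.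
Proof. by rewrite mp_lact1 counit_gelt scale1r. Qed.

Lemma mp_lact_geltK g a : gelt g^-1%g |>[mp] (gelt g |>[mp] a) = a.
Proof.
by have [lact1 lactM _ _] := mp_lmodcoalg mp; rewrite -lactM geltM mulVg lact1.
Qed.

Lemma mp_lact_gelt_coalg g : coalg_morph (fun a => gelt g |>[mp] a).
Proof.
have [_ _ comul_lact counit_lact] := mp_lmodcoalg mp.
split=> [|a|a]; first by lin.
  by rewrite comul_lact comul_gelt tlift_tens //; lin.
by rewrite counit_lact counit_gelt mul1r.
Qed.

Lemma mp_swap_gelt g a :
  \tsum_(a1, a2 <- comul a) ((gelt g <|[mp] a1) \ox (gelt g |>[mp] a2)) =
  \tsum_(a1, a2 <- comul a) ((gelt g <|[mp] a2) \ox (gelt g |>[mp] a1)).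
Proof.
by have := mp_swap mp (gelt g) a; rewrite comul_gelt !tlift_tens //; lin.
Qed.

Lemma mp_lact_gelt_mul g a b :
    (forall a, gelt g <|[mp] a = counit a *: gelt g) ->
  gelt g |>[mp] (a * b) = (gelt g |>[mp] a) * (gelt g |>[mp] b).
Proof.
move=> ract_triv; rewrite mp_lactM comul_gelt tlift_tens; try by lin.
rewrite -(tlift_counitr (L := fun a => (gelt g |>[mp] a) * (gelt g |>[mp] b)));
  last by lin.
apply: eq_tlift => a1 a2.
by rewrite ract_triv tensZl linearZ /= scalerAr.
Qed.

End GroupLikeActions.

End GroupAlgebra.

Section ActionMatchedPair.
Context {K : fieldType} {gT : finGroupType} {T : hopfAlgType K}.
Variable (phi : hopfAction gT T).
Local Notation KG := (groupAlg K gT).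

Definition act_lact : 'Hom((KG \ox T)%type, T) :=
  linfun (tlift (fun (y : KG) a => galg_ext (fun g => phi g a) y)).

Definition act_ract : 'Hom((KG \ox T)%type, KG) :=
  linfun (tlift (fun (y : KG) (a : T) => counit a *: y)).

Lemma act_lact_gelt g a : act_lact (gelt g \ox a) = phi g a.
Proof. by rewrite lfunE /= tlift_tens ?galg_ext_gelt //; lin. Qed.

Lemma act_ractE y a : act_ract (y \ox a) = counit a *: y.
Proof. by rewrite lfunE /= tlift_tens //; lin. Qed.

Lemma act_left_module_coalgebra : is_left_module_coalgebra act_lact.
Proof.
split=> [a|y z a|y a|y a].
- by rewrite act_lact_gelt hact1.
- move: y; apply: galg_linP => [||g]; [by lin | by lin |].
  move: z; apply: galg_linP => [||g']; [by lin | by lin |].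
  by rewrite geltM !act_lact_gelt hactM.
- move: y; apply: galg_linP => [||g]; [by lin | by lin |].
  rewrite act_lact_gelt hact_comul comul_gelt tlift_tens; try by lin.
  by apply: eq_tlift => a1 a2; rewrite !act_lact_gelt.
- move: y; apply: galg_scalarP => [||g]; [by lin | by lin |].
  by rewrite act_lact_gelt hact_counit counit_gelt mul1r.
Qed.

Lemma act_right_module_coalgebra : is_right_module_coalgebra act_ract.
Proof.
split=> [y|y a b|y a|y a].
- by rewrite act_ractE counit1 scale1r.
- by rewrite !act_ractE counitM scalerA mulrC.
- move: y; apply: galg_linP => [||g]; [by lin | by lin |].
  rewrite act_ractE linearZ /= comul_gelt tlift_tens; try by lin.
  pose L (b : T) := counit b *: (gelt g \ox gelt g : (KG \ox KG)%type).
  rewrite -[LHS]/(L a) -tlift_counitl; last by rewrite /L; lin.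
  by apply: eq_tlift => a1 a2; rewrite !act_ractE tensZl tensZr.
- by rewrite act_ractE linearZ mulrC.
Qed.

Lemma act_lact1 (y : KG) : act_lact (y \ox 1) = counit y *: 1.
Proof.
move: y; apply: galg_linP => [||g]; [by lin | by lin |].
by rewrite act_lact_gelt (rmorph1 (phi g)) counit_gelt scale1r.
Qed.

Lemma act_ract1 a : act_ract (1 \ox a) = counit a *: 1.
Proof. exact: act_ractE. Qed.

Lemma act_lactM (y : KG) (a b : T) :
  act_lact (y \ox (a * b)) =
  \tsum_(y1, y2 <- comul y) \tsum_(a1, a2 <- comul a)
    (act_lact (y1 \ox a1) * act_lact (act_ract (y2 \ox a2) \ox b)).
Proof.
move: y; apply: galg_linP => [||g]; [by lin | by lin |].
rewrite comul_gelt tlift_tens; try by lin.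
rewrite act_lact_gelt (rmorphM (phi g)).
rewrite -(tlift_counitr (L := fun a => phi g a * phi g b)); last by lin.
apply: eq_tlift => a1 a2.
by rewrite act_ractE tensZl linearZ /= !act_lact_gelt scalerAr.
Qed.

Lemma act_ractM (y z : KG) (a : T) :
  act_ract ((y * z) \ox a) =
  \tsum_(z1, z2 <- comul z) \tsum_(a1, a2 <- comul a)
    (act_ract (y \ox act_lact (z1 \ox a1)) * act_ract (z2 \ox a2)).
Proof.
move: z; apply: galg_linP => [||g]; [by lin | by lin |].
rewrite comul_gelt tlift_tens; try by lin.
rewrite act_ractE.
rewrite -(tlift_counitl (L := fun a => counit a *: (y * gelt g))); last by lin.
apply: eq_tlift => a1 a2.
by rewrite !act_ractE act_lact_gelt hact_counit -scalerAl -scalerAr.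
Qed.

Lemma act_swap (y : KG) (a : T) :
  \tsum_(y1, y2 <- comul y) \tsum_(a1, a2 <- comul a)
    (act_ract (y1 \ox a1) \ox act_lact (y2 \ox a2)) =
  \tsum_(y1, y2 <- comul y) \tsum_(a1, a2 <- comul a)
    (act_ract (y2 \ox a2) \ox act_lact (y1 \ox a1)).
Proof.
move: y; apply: galg_linP => [||g]; [by lin | by lin |].
rewrite !comul_gelt !tlift_tens; try by lin.
pose L (b : T) : (KG \ox T)%type := gelt g \ox phi g b.
transitivity (L a).
  rewrite -(tlift_counitl (L := L)); last by rewrite /L; lin.
  by apply: eq_tlift => a1 a2; rewrite act_ractE act_lact_gelt tensZl.
rewrite -(tlift_counitr (L := L)); last by rewrite /L; lin.
by apply: eq_tlift => a1 a2; rewrite act_ractE act_lact_gelt tensZl.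
Qed.

Definition act_matchedPair : matchedPair T KG :=
  MatchedPair act_left_module_coalgebra act_right_module_coalgebra
    act_lact1 act_ract1 act_lactM act_ractM act_swap.

End ActionMatchedPair.

Section BicrossedSkew.
Context {K : fieldType} {gT : finGroupType} {T : hopfAlgType K}.
Variable (phi : hopfAction gT T).
Local Notation KG := (groupAlg K gT).
Local Notation B := (skewGroupAlg phi).
Local Notation bicrossed_phi := (bicrossed (act_matchedPair phi)).

Definition bicrossed_to_skew : {linear (T \ox KG)%type -> B} :=
  tlift (fun a (y : KG) => galg_ext (fun g => single g a : B) y).

Lemma bicrossed_to_skewE a g : bicrossed_to_skew (a \ox gelt g) = single g a.
Proof. by rewrite /= tlift_tens ?galg_ext_gelt //; lin. Qed.

Lemma bicrossed_to_skew_bij : bijective bicrossed_to_skew.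
Proof.
pose t g (a : T) : (T \ox KG)%type := a \ox gelt g.
have t_linear g : linear (t g) by rewrite /t; lin.
pose tens_gelt g := HB.pack_for {linear T -> (T \ox KG)%type} (t g)
  (GRing.isLinear.Build K T (T \ox KG)%type *:%R (t g) (t_linear g)).
pose inv : {linear B -> (T \ox KG)%type} := skew_ext tens_gelt.
have invE g a : inv (single g a) = a \ox gelt g by apply: skew_ext_single.
exists inv.
- apply: tens_galg_linP => [||a g]; [by lin | by lin |].
  by rewrite bicrossed_to_skewE invE.
- apply: skew_linP => [||g a]; [by lin | by lin |].
  by rewrite invE bicrossed_to_skewE.
Qed.

Lemma bicrossed_to_skewM s t :
  bicrossed_to_skew (hd_mul bicrossed_phi s t) =
  bicrossed_to_skew s * bicrossed_to_skew t.
Proof.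
move: s; apply: tens_galg_linP => [||a g]; [by lin | by lin |].
move: t; apply: tens_galg_linP => [||b g']; [by lin | by lin |].
pose L (b' : T) : (T \ox KG)%type := (a * phi g b') \ox gelt (g * g')%g.
rewrite !bicrossed_to_skewE singleM -bicrossed_to_skewE.
rewrite -[RHS]/(bicrossed_to_skew (L b)) -(tlift_counitr (L := L)); last first.
  by rewrite /L; lin.
congr (bicrossed_to_skew _); rewrite /= !tlift_tens; try by lin.
rewrite comul_gelt tlift_tens; try by lin.
apply: eq_tlift => b1 b2.
by rewrite act_lact_gelt act_ractE -scalerAl geltM tensZr.
Qed.

Lemma bicrossed_to_skew_comul s :
  \tsum_(s1, s2 <- hd_comul bicrossed_phi s)
    (bicrossed_to_skew s1 \ox bicrossed_to_skew s2) =
  comul (bicrossed_to_skew s).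
Proof.
move: s; apply: tens_galg_linP => [||a g]; [by lin | by lin |].
rewrite bicrossed_to_skewE [RHS]skew_comul_single /= tlift_tens; try by lin.
rewrite tlift_linear; last by lin.
apply: eq_tlift => a1 a2; rewrite comul_gelt tlift_tens; try by lin.
by rewrite tlift_tens ?bicrossed_to_skewE //; lin.
Qed.

Lemma bicrossed_to_skew_counit s :
  hd_counit bicrossed_phi s = counit (bicrossed_to_skew s).
Proof.
move: s; apply: (@tens_galg_linP _ _ _ K^o) => [||a g]; [by lin | by lin |].
rewrite bicrossed_to_skewE [RHS]skew_counit_single /= tlift_tens; try by lin.
by rewrite counit_gelt mulr1.
Qed.

Lemma bicrossed_to_skew_antipode s :
  bicrossed_to_skew (hd_antipode bicrossed_phi s) =
  antipode (bicrossed_to_skew s).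
Proof.
move: s; apply: tens_galg_linP => [||a g]; [by lin | by lin |].
pose L (b : T) : (T \ox KG)%type := phi g^-1%g (antipode b) \ox gelt g^-1%g.
rewrite bicrossed_to_skewE [RHS]skew_antipode_single -bicrossed_to_skewE.
rewrite -[RHS]/(bicrossed_to_skew (L a)) -(tlift_counitl (L := L)); last first.
  by rewrite /L; lin.
congr (bicrossed_to_skew _); rewrite /= tlift_tens; try by lin.
apply: eq_tlift => a1 a2.
rewrite comul_gelt tlift_tens; try by lin.
by rewrite antipode_gelt act_lact_gelt act_ractE counit_antipode tensZr.
Qed.

Lemma bicrossed_skew_isomorphic :
  hopf_isomorphic bicrossed_phi (hopf_data B).
Proof.
exists bicrossed_to_skew; split; first exact: bicrossed_to_skew_bij.
split; first exact: bicrossed_to_skewE.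
- exact: bicrossed_to_skewM.
- exact: bicrossed_to_skew_comul.
- exact: bicrossed_to_skew_counit.
- exact: bicrossed_to_skew_antipode.
Qed.

End BicrossedSkew.

(** * Presentations of skew group algebras *)

Section SkewSection.
Context {K : fieldType} {gT : finGroupType} {T : hopfAlgType K}.
Context {phi : hopfAction gT T} {N M : nat}.
Variables (w : N.-tuple gT) (u : M.-tuple T).
Variables (relsG : seq (freeAlg K N)) (relsT : seq (freeAlg K M)).
Variable cross : 'I_N -> 'I_M -> freeAlg K M.
Local Notation B := (skewGroupAlg phi).
Local Notation KG := (groupAlg K gT).
Local Notation wK := (map_tuple gelt w : N.-tuple KG).

Hypothesis G_presented : is_presented wK relsG.
Hypothesis T_presented : is_presented u relsT.
Hypothesis crossE : forall i j,
  nceval u (cross i j) = phi (tnth w i) (tnth u j).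

Context {R : algType K} (rels : seq R).
Variables (inG : {lrmorphism freeAlg K N -> R}).
Variables (inT : {lrmorphism freeAlg K M -> R}).
Local Notation "p === r" := (eqmod rels p r) (at level 70).

Hypothesis inG_rels : {in relsG, forall p, in_ideal_gen rels (inG p)}.
Hypothesis inT_rels : {in relsT, forall p, in_ideal_gen rels (inT p)}.
Hypothesis cross_rels : forall i j,
  inG (ncvar K i) * inT (ncvar K j) === inT (cross i j) * inG (ncvar K i).

Lemma eqmod_inG p r : nceval wK p = nceval wK r -> inG p === inG r.
Proof.
move/(presented_eqmod G_presented); rewrite /eqmod -linearB.
exact: ideal_rmorph_sub.
Qed.

Lemma eqmod_inT p r : nceval u p = nceval u r -> inT p === inT r.
Proof.
move/(presented_eqmod T_presented); rewrite /eqmod -linearB.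
exact: ideal_rmorph_sub.
Qed.

Let sG := sval (presented_section G_presented).
Let sT := sval (presented_section T_presented).
Let sGK : cancel sG (nceval wK) := svalP (presented_section G_presented).
Let sTK : cancel sT (nceval u) := svalP (presented_section T_presented).

Lemma eqmod_cross i p r : nceval u r = phi (tnth w i) (nceval u p) ->
  inG (ncvar K i) * inT p === inT r * inG (ncvar K i).
Proof.
move: p r; apply: free_ind => [a p p' IHp IHp'||j p IHp] r.
- rewrite ncevalD ncevalZ linearP => rE.
  rewrite linearP mulrDr -scalerAr.
  apply: eqmod_trans (eqmodD (eqmodZ a (IHp _ (sTK _))) (IHp' _ (sTK _))) _.
  rewrite scalerAl -mulrDl -linearP; apply/eqmodMr/eqmod_inT.
  by rewrite ncevalD ncevalZ !sTK.
- rewrite nceval1 (rmorph1 (phi _)) (rmorph1 inT) mulr1 -[X in X === _]mul1r.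
  by rewrite -(rmorph1 inT) => r1; apply/eqmodMr/eqmod_inT; rewrite nceval1.
- rewrite ncevalM nceval_var (rmorphM (phi _)) (rmorphM inT) mulrA => rE.
  apply: eqmod_trans (eqmodMr _ (cross_rels i j)) _; rewrite -mulrA.
  apply: eqmod_trans (eqmodMl _ (IHp _ (sTK _))) _.
  rewrite mulrA -(rmorphM inT).
  by apply/eqmodMr/eqmod_inT; rewrite ncevalM crossE sTK.
Qed.

(* A linear section of the evaluation map, built from sections for [T] and K[G].
   Modulo the relators it commutes with left multiplication by the generators,
   so every polynomial is congruent to the section of its value. *)
Definition skew_section (b : B) : R :=
  \sum_g inT (sT (b g)) * inG (sG (gelt g)).

Lemma skew_section_is_linear : linear skew_section.
Proof.
move=> a b b'; rewrite /skew_section scaler_sumr -big_split;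
  apply: eq_bigr => g _.
by rewrite !ffunE !linearP mulrDl scalerAl.
Qed.

HB.instance Definition _ :=
  GRing.isLinear.Build K B R *:%R skew_section skew_section_is_linear.

Lemma skew_section_single g a :
  skew_section (single g a) = inT (sT a) * inG (sG (gelt g)).
Proof.
rewrite /skew_section (bigD1 g) //= ffunE eqxx big1 ?addr0 // => g' /negPf gg'.
by rewrite ffunE gg' !linear0 mul0r.
Qed.

Lemma skew_section1 : skew_section 1 === 1.
Proof.
rewrite skew1E skew_section_single -[X in _ === X]mulr1.
apply: (eqmod_trans (eqmodMl _ (_ : _ === inG 1))).
  by apply: eqmod_inG; rewrite sGK nceval1.
rewrite (rmorph1 inG); apply: eqmodMr; rewrite -(rmorph1 inT).
by apply: eqmod_inT; rewrite sTK nceval1.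
Qed.

Lemma skew_section_mulG i b :
  inG (ncvar K i) * skew_section b === skew_section (single (tnth w i) 1 * b).
Proof.
rewrite (skewE b) (linear_sum skew_section) !mulr_sumr.
rewrite (linear_sum skew_section).
apply: eqmod_sum => g /=.
rewrite singleM mul1r !skew_section_single mulrA.
apply: eqmod_trans (eqmodMr _ (eqmod_cross (sTK _))) _.
rewrite sTK -mulrA -(rmorphM inG); apply: eqmodMl; apply: eqmod_inG.
by rewrite ncevalM nceval_var !sGK tnth_map geltM.
Qed.

Lemma skew_section_mulT j b :
  inT (ncvar K j) * skew_section b === skew_section (single 1%g (tnth u j) * b).
Proof.
rewrite (skewE b) (linear_sum skew_section) !mulr_sumr.
rewrite (linear_sum skew_section).
apply: eqmod_sum => g /=.
rewrite singleM mul1g hact1 !skew_section_single mulrA -(rmorphM inT).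
by apply/eqmodMr/eqmod_inT; rewrite ncevalM nceval_var !sTK.
Qed.

End SkewSection.

Section SkewPresentation.
Context {K : fieldType} {gT : finGroupType} {T : hopfAlgType K}.
Context {phi : hopfAction gT T} {N M : nat}.
Variables (w : N.-tuple gT) (u : M.-tuple T).
Variables (relsG : seq (freeAlg K N)) (relsT : seq (freeAlg K M)).
Variable cross : 'I_N -> 'I_M -> freeAlg K M.
Local Notation B := (skewGroupAlg phi).
Local Notation KG := (groupAlg K gT).
Local Notation wK := (map_tuple gelt w : N.-tuple KG).
Local Notation inG := (nc_rename (lshift M)).
Local Notation inT := (nc_rename (@rshift N M)).

Definition skew_gens : (N + M).-tuple B :=
  cat_tuple (map_tuple (single^~ 1) w) (map_tuple (single 1%g) u).

Definition skew_relators : seq (ncpoly K (N + M)) :=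
  [seq inG p | p <- relsG] ++ [seq inT p | p <- relsT] ++
  [seq inG (ncvar K i) * inT (ncvar K j) - inT (cross i j) * inG (ncvar K i)
     | i <- enum 'I_N, j <- enum 'I_M].

Definition galg_single : KG -> B := galg_ext (fun g => single g 1).

HB.instance Definition _ := GRing.Linear.on galg_single.

Lemma galg_single_gelt g : galg_single (gelt g) = single g 1.
Proof. exact: galg_ext_gelt. Qed.

Lemma galg_single_is_monoid_morphism : monoid_morphism galg_single.
Proof.
split=> [|y z]; first exact: galg_single_gelt.
move: y; apply: galg_linP => [||g]; [by lin | by lin |].
move: z; apply: galg_linP => [||g']; [by lin | by lin |].
by rewrite geltM !galg_single_gelt singleM mul1r (rmorph1 (phi _)).
Qed.

HB.instance Definition _ :=
  GRing.isMonoidMorphism.Build KG B galg_single galg_single_is_monoid_morphism.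

Lemma single1_is_monoid_morphism : monoid_morphism (@single K gT T phi 1%g).
Proof. by split=> // a b; rewrite singleM mulg1 hact1. Qed.

HB.instance Definition _ :=
  GRing.isMonoidMorphism.Build T B (@single K gT T phi 1%g)
    single1_is_monoid_morphism.

Lemma single1_coalg_morph : coalg_morph (@single K gT T phi 1%g).
Proof.
by split; [lin | exact: skew_comul_single | exact: skew_counit_single].
Qed.

Lemma skew_gens_lshift i : tnth skew_gens (lshift M i) = single (tnth w i) 1.
Proof. by rewrite tnth_lshift tnth_map. Qed.

Lemma skew_gens_rshift j : tnth skew_gens (rshift N j) = single 1%g (tnth u j).
Proof. by rewrite tnth_rshift tnth_map. Qed.

Lemma nceval_skew_inG p : nceval skew_gens (inG p) = galg_single (nceval wK p).
Proof.
rewrite (nceval_rename (w := map_tuple galg_single wK)) => [|i]; last first.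
  by rewrite skew_gens_lshift !tnth_map galg_single_gelt.
by apply: (nceval_lrmorphism (f := galg_single)) => i; rewrite tnth_map.
Qed.

Lemma nceval_skew_inT p : nceval skew_gens (inT p) = single 1%g (nceval u p).
Proof.
rewrite (nceval_rename (w := map_tuple (single 1%g) u)) => [|j]; last first.
  by rewrite skew_gens_rshift tnth_map.
by apply: (nceval_lrmorphism (f := single 1%g)) => j; rewrite tnth_map.
Qed.

Hypothesis G_presented : is_presented wK relsG.
Hypothesis T_presented : is_presented u relsT.
Hypothesis crossE : forall i j,
  nceval u (cross i j) = phi (tnth w i) (tnth u j).

Lemma skew_relators_eval0 :
    {in skew_relators, forall p, nceval skew_gens p = 0}.
Proof.
move=> p; rewrite !mem_cat => /or3P[/mapP[r rG ->]|/mapP[r rT ->]|].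
- by rewrite nceval_skew_inG (presented_rel G_presented) ?linear0.
- by rewrite nceval_skew_inT (presented_rel T_presented) ?linear0.
case/allpairsP=> -[i j] [_ _ ->] /=.
rewrite (eq_ncevalB (eq_ncevalM (nceval_skew_inG _) (nceval_skew_inT _))
  (eq_ncevalM (nceval_skew_inT _) (nceval_skew_inG _))).
rewrite !nceval_var crossE tnth_map galg_single_gelt !singleM.
by rewrite hact1 mulg1 mul1g mul1r mulr1 subrr.
Qed.

Lemma skew_presented : is_presented skew_gens skew_relators.
Proof.
have inG_rels : {in relsG, forall p, in_ideal_gen skew_relators (inG p)}.
  by move=> p pG; apply: ideal_mem; rewrite mem_cat map_f.
have inT_rels : {in relsT, forall p, in_ideal_gen skew_relators (inT p)}.
  by move=> p pT; apply: ideal_mem; rewrite !mem_cat map_f ?orbT.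
have cross_rels i j : eqmod skew_relators (inG (ncvar K i) * inT (ncvar K j))
    (inT (cross i j) * inG (ncvar K i)).
  apply: ideal_mem; rewrite !mem_cat; apply/or3P/Or33.
  by apply: allpairs_f; rewrite mem_enum.
pose s : {linear B -> ncpoly K (N + M)} :=
  skew_section G_presented T_presented inG inT.
apply: (presented_of_section (s := s)) => [|b||r b].
- exact: skew_relators_eval0.
- rewrite [RHS]skewE linear_sum; apply: eq_bigr => g _.
  apply: etrans (eq_ncevalM (nceval_skew_inT _) (nceval_skew_inG _)) _.
  rewrite !(svalP (presented_section _)) galg_single_gelt singleM.
  by rewrite mul1g (rmorph1 (phi _)) mulr1.
- exact: (skew_section1 G_presented T_presented inG_rels inT_rels).
- case: (split_ordP r) => [i|j] ->.
    rewrite skew_gens_lshift -(nc_rename_var (lshift M)).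
    exact: (skew_section_mulG G_presented T_presented crossE inG_rels inT_rels
      cross_rels).
  rewrite skew_gens_rshift -(nc_rename_var (@rshift N M)).
  exact: (skew_section_mulT G_presented T_presented inG inT_rels).
Qed.

End SkewPresentation.

(** * The group [D_ln^k] *)

Section DlnkModel.
Context (k l n : nat) (l_gt0 : (0 < l)%N) (n_gt0 : (0 < n)%N).
Hypothesis kl_mod_n : (k ^ l = 1 %[mod n])%N.

Lemma expn_modr_order i : (k ^ (i %% l) = k ^ i %[mod n])%N.
Proof.
rewrite [in RHS](divn_eq i l) expnD (mulnC (i %/ l)%N) expnM.
by rewrite -[in RHS]modnMml -[in RHS]modnXm kl_mod_n modnXm exp1n modnMml mul1n.
Qed.

(* The right regular representation on the normal forms [d ^+ a * c ^+ b]. *)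
Definition model_c (u : 'I_n * 'I_l) : 'I_n * 'I_l :=
  (u.1, Ordinal (ltn_pmod (u.2 + 1) l_gt0)).
Definition model_d (u : 'I_n * 'I_l) : 'I_n * 'I_l :=
  (Ordinal (ltn_pmod (u.1 + k ^ u.2) n_gt0), u.2).

Lemma model_c_inj : injective model_c.
Proof.
move=> [a b] [a' b'] [-> /eqP]; rewrite eqn_modDr !modn_small // => /eqP bb'.
by congr (_, _); apply: val_inj.
Qed.

Lemma model_d_inj : injective model_d.
Proof.
move=> [a b] [a' b'] [/eqP + bb']; rewrite bb' eqn_modDr !modn_small //.
by move=> /eqP aa'; congr (_, _); apply: val_inj.
Qed.

Let C := perm model_c_inj.
Let D := perm model_d_inj.

Lemma model_cX i u : (C ^+ i)%g u = (u.1, Ordinal (ltn_pmod (u.2 + i) l_gt0)).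
Proof.
elim: i => [|i IH].
  rewrite expg0 perm1 [LHS]surjective_pairing; congr (_, _); apply: val_inj.
  by rewrite /= addn0 modn_small.
rewrite expgSr permM IH permE /model_c; congr (_, _); apply: val_inj.
by rewrite /= modnDml addn1 addnS.
Qed.

Lemma model_dX i u :
  (D ^+ i)%g u = (Ordinal (ltn_pmod (u.1 + i * k ^ u.2) n_gt0), u.2).
Proof.
elim: i => [|i IH].
  rewrite expg0 perm1 [LHS]surjective_pairing; congr (_, _); apply: val_inj.
  by rewrite /= addn0 modn_small.
rewrite expgSr permM IH permE /model_d; congr (_, _); apply: val_inj.
by rewrite /= modnDml mulSnr addnA.
Qed.

Lemma model_cl : (C ^+ l = 1)%g.
Proof.
apply/permP => u; rewrite model_cX perm1 [RHS]surjective_pairing.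
by congr (_, _); apply: val_inj; rewrite /= modnDr modn_small.
Qed.

Lemma model_dn : (D ^+ n = 1)%g.
Proof.
apply/permP => u; rewrite model_dX perm1 [RHS]surjective_pairing.
by congr (_, _); apply: val_inj; rewrite /= addnC mulnC modnMDl modn_small.
Qed.

Lemma model_cd : (C * D = D ^+ k * C)%g.
Proof.
apply/permP => u; rewrite !permM model_dX !permE /model_c /model_d /=.
congr (_, _); apply: val_inj => /=.
by rewrite -modnDmr expn_modr_order modnDmr addn1 expnS.
Qed.

Lemma model_nf_inj :
  injective (fun u : 'I_n * 'I_l => D ^+ u.1 * C ^+ u.2)%g.
Proof.
move=> u u' /(congr1 (fun s : {perm _} => s (Ordinal n_gt0, Ordinal l_gt0))).
rewrite !permM !model_dX !model_cX /= => -[].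
rewrite expn0 !muln1 !add0n !modn_small // => e1 e2.
by apply/eqP; rewrite -pair_eqE /= -!val_eqE /= e1 e2 !eqxx.
Qed.

Lemma Dlnk_card_ge (gT : finGroupType) (c d : gT) :
  is_Dlnk k l n c d -> (n * l <= #|gT|)%N.
Proof.
case=> isoD _ _ _ _; pose H := (<[C]> <*> <[D]>)%G.
have: (H \homg [set: gT])%g.
  rewrite isoD; apply/existsP; exists (C, D).
  by rewrite /= model_cl model_dn model_cd !xpair_eqE !eqxx.
move/leq_homg; rewrite cardsT; apply: leq_trans.
have -> : (n * l = #|{: 'I_n * 'I_l}|)%N by rewrite card_prod !card_ord.
rewrite -(card_imset _ model_nf_inj); apply/subset_leq_card/subsetP.
move=> _ /imsetP[u _ ->].
by rewrite groupM // groupX // mem_gen // inE cycle_id ?orbT.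
Qed.

End DlnkModel.

Section DlnkNormalForm.
Context (k l n : nat) (gT : finGroupType) (c d : gT).
Hypotheses (l_gt0 : (0 < l)%N) (n_gt0 : (0 < n)%N).
Hypotheses (kl_mod_n : (k ^ l = 1 %[mod n])%N) (gT_D : is_Dlnk k l n c d).

Lemma Dlnk_commX i t : (c ^+ i * d ^+ t = d ^+ (k ^ i * t) * c ^+ i)%g.
Proof.
have [_ _ _ _ cd] := gT_D.
have cdX s : (c * d ^+ s = d ^+ (k * s) * c)%g.
  elim: s => [|s IH]; first by rewrite muln0 !expg0 mulg1 mul1g.
  by rewrite expgSr mulgA IH -mulgA cd mulgA -expgD mulnS addnC.
elim: i t => [|i IH] t; first by rewrite !expg0 mulg1 mul1g mul1n.
by rewrite expgSr -mulgA cdX mulgA IH -mulgA expnSr mulnA.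
Qed.

Lemma Dlnk_mul t i t' i' :
  (d ^+ t * c ^+ i * (d ^+ t' * c ^+ i') =
   d ^+ (t + k ^ i * t') * c ^+ (i + i'))%g.
Proof.
by rewrite !expgD !mulgA -[in LHS](mulgA _ (c ^+ i)%g) Dlnk_commX !mulgA.
Qed.

Lemma Dlnk_mod t i : (d ^+ t * c ^+ i = d ^+ (t %% n) * c ^+ (i %% l))%g.
Proof. by have [_ _ cl dn _] := gT_D; rewrite !expg_mod. Qed.

Definition Dlnk_nf (u : 'I_n * 'I_l) : gT := (d ^+ u.1 * c ^+ u.2)%g.

Lemma Dlnk_nf_surj g : exists u, g == Dlnk_nf u.
Proof.
have [_ gen cl dn _] := gT_D.
have nfE t i : (d ^+ t * c ^+ i)%g \in Dlnk_nf @: setT.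
  rewrite Dlnk_mod; apply/imsetP.
  by exists (Ordinal (ltn_pmod t n_gt0), Ordinal (ltn_pmod i l_gt0)).
have nf_group : group_set (Dlnk_nf @: setT).
  apply/group_setP; split; first by have := nfE 0 0; rewrite !expg0 mulg1.
  by move=> _ _ /imsetP[u _ ->] /imsetP[u' _ ->]; rewrite Dlnk_mul; apply: nfE.
suff /subsetP/(_ g) : [set: gT] \subset Group nf_group.
  by rewrite inE => /(_ isT)/imsetP[u _ ->]; exists u.
rewrite -gen gen_subG subUset !sub1set /=.
by have := nfE 0 1; have := nfE 1 0; rewrite !expg0 !expg1 mulg1 mul1g => -> ->.
Qed.

Lemma Dlnk_nf_inj : injective Dlnk_nf.
Proof.
suff /imset_injP inj : #|Dlnk_nf @: setT| == #|[set: 'I_n * 'I_l]|.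
  by move=> u u' uu'; apply: inj; rewrite ?inE.
rewrite eqn_leq leq_imset_card cardsT card_prod !card_ord.
apply: leq_trans (Dlnk_card_ge l_gt0 n_gt0 kl_mod_n gT_D) _.
rewrite -cardsT; apply/subset_leq_card/subsetP => g _.
by have [u /eqP->] := Dlnk_nf_surj g; apply: imset_f.
Qed.

Definition Dlnk_code g : 'I_n * 'I_l := xchoose (Dlnk_nf_surj g).

Lemma Dlnk_codeK g : (d ^+ (Dlnk_code g).1 * c ^+ (Dlnk_code g).2)%g = g.
Proof. exact/esym/eqP/(xchooseP (Dlnk_nf_surj g)). Qed.

Lemma Dlnk_code_nf t i : Dlnk_code (d ^+ t * c ^+ i)%g =
  (Ordinal (ltn_pmod t n_gt0), Ordinal (ltn_pmod i l_gt0)).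
Proof. by apply: Dlnk_nf_inj; rewrite /Dlnk_nf Dlnk_codeK Dlnk_mod. Qed.

Section Words.
Context {R : pzRingType} (rels : seq R) (C D : R).
Local Notation "u === v" := (eqmod rels u v) (at level 70).
Hypotheses (Cl : C ^+ l === 1) (Dn : D ^+ n === 1) (CD : C * D === D ^+ k * C).

Definition Dlnk_word g : R := D ^+ (Dlnk_code g).1 * C ^+ (Dlnk_code g).2.

Lemma Dlnk_word_nf t i : D ^+ t * C ^+ i === Dlnk_word (d ^+ t * c ^+ i)%g.
Proof.
rewrite /Dlnk_word Dlnk_code_nf /=.
apply: eqmod_trans (eqmodMr _ (eqmod_exp_modn t Dn)) _.
exact/eqmodMl/eqmod_exp_modn.
Qed.

Lemma Dlnk_word1 : Dlnk_word 1%g === 1.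
Proof.
have := Dlnk_word_nf 0 0; rewrite !expg0 !expr0 mulg1 mulr1.
exact: eqmod_sym.
Qed.

Lemma Dlnk_word_mulD g : D * Dlnk_word g === Dlnk_word (d * g)%g.
Proof.
rewrite -{2}(Dlnk_codeK g) mulgA -expgS {1}/Dlnk_word mulrA -exprS.
exact: Dlnk_word_nf.
Qed.

Lemma Dlnk_word_mulC g : C * Dlnk_word g === Dlnk_word (c * g)%g.
Proof.
have CDX t : C * D ^+ t === D ^+ (k * t) * C.
  elim: t => [|t IH].
    by rewrite muln0 !expr0 mulr1 mul1r; apply: eqmod_refl.
  rewrite exprSr mulrA; apply: eqmod_trans (eqmodMr _ IH) _.
  by rewrite mulnS addnC exprD -!mulrA; apply: eqmodMl.
rewrite -{2}(Dlnk_codeK g) mulgA -[c in (c * _ * _)%g]expg1 Dlnk_commX expn1.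
rewrite -mulgA -expgD add1n {1}/Dlnk_word mulrA.
apply: eqmod_trans (eqmodMr _ (CDX _)) _.
by rewrite -mulrA -exprS; apply: Dlnk_word_nf.
Qed.

End Words.

End DlnkNormalForm.

Section GroupAlgebraLift.
Context {K : fieldType} {gT : finGroupType}.
Local Notation KG := (groupAlg K gT).

Lemma geltX g i : (gelt g : KG) ^+ i = gelt (g ^+ i)%g.
Proof. by elim: i => [|i IH]; rewrite ?expr0 // exprS expgS IH geltM. Qed.

Definition galg_lift {R : lmodType K} (F : gT -> R) (y : KG) : R :=
  \sum_g y g *: F g.

Lemma galg_lift_is_linear (R : lmodType K) (F : gT -> R) : linear (galg_lift F).
Proof.
move=> a y z; rewrite /galg_lift scaler_sumr -big_split /=.
by apply: eq_bigr => g _; rewrite !ffunE scalerDl scalerA.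
Qed.

HB.instance Definition _ (R : lmodType K) (F : gT -> R) :=
  GRing.isLinear.Build K KG R *:%R (galg_lift F) (galg_lift_is_linear F).

Lemma galg_lift_gelt (R : lmodType K) (F : gT -> R) g :
  galg_lift F (gelt g) = F g.
Proof.
rewrite /galg_lift (bigD1 g) //= big1 => [|g' /negPf gg']; rewrite ffunE.
  by rewrite eqxx scale1r addr0.
by rewrite gg' scale0r.
Qed.

Lemma eqmod_galg_lift (R : algType K) (rels : seq R) (F : gT -> R) (X : R) g :
    (forall g', eqmod rels (X * F g') (F (g * g')%g)) ->
  forall y, eqmod rels (X * galg_lift F y) (galg_lift F (gelt g * y)).
Proof.
move=> XF y; rewrite (galgE y) (linear_sum (galg_lift F)) !mulr_sumr.
rewrite (linear_sum (galg_lift F)); apply: eqmod_sum => g' /=.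
rewrite -scalerAr !linearZ geltM /= !galg_lift_gelt -scalerAr.
exact: eqmodZ.
Qed.

End GroupAlgebraLift.

Definition Dlnk_relators (K : fieldType) (k l n : nat) : seq (freeAlg K 2) :=
  let c := ncvar K (0 : 'I_2) in let d := ncvar K (1 : 'I_2) in
  [:: c ^+ l - 1; d ^+ n - 1; c * d - d ^+ k * c].

Section DlnkAlgebra.
Context (K : fieldType) (k l n : nat) (gT : finGroupType) (c d : gT).
Hypotheses (l_gt0 : (0 < l)%N) (n_gt0 : (0 < n)%N).
Hypotheses (kl_mod_n : (k ^ l = 1 %[mod n])%N) (gT_D : is_Dlnk k l n c d).
Local Notation KG := (groupAlg K gT).
Local Notation gens := (map_tuple gelt [tuple c; d] : 2.-tuple KG).

Lemma Dlnk_relators_eval0 :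
  {in Dlnk_relators K k l n, forall p, nceval gens p = 0}.
Proof.
have [_ _ cl dn cd] := gT_D.
have vc := nceval_var gens 0; have vd := nceval_var gens 1.
move=> p; rewrite !inE => /or3P[] /eqP->.
- by rewrite (eq_ncevalB (eq_ncevalX l vc) (nceval1 _)) geltX cl subrr.
- by rewrite (eq_ncevalB (eq_ncevalX n vd) (nceval1 _)) geltX dn subrr.
- rewrite (eq_ncevalB (eq_ncevalM vc vd) (eq_ncevalM (eq_ncevalX k vd) vc)).
  by rewrite geltX !geltM cd subrr.
Qed.

Lemma Dlnk_galg_presented : is_presented gens (Dlnk_relators K k l n).
Proof.
set rels := Dlnk_relators K k l n.
pose C : ncpoly K 2 := ncvar K 0; pose D : ncpoly K 2 := ncvar K 1.
have rel i : (i < 3)%N -> in_ideal_gen rels (nth 0 rels i).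
  by move=> i3; apply/ideal_mem/mem_nth.
have Cl : eqmod rels (C ^+ l) 1 by apply: (rel 0).
have Dn : eqmod rels (D ^+ n) 1 by apply: (rel 1).
have CD : eqmod rels (C * D) (D ^+ k * C) by apply: (rel 2).
pose word := Dlnk_word l_gt0 n_gt0 gT_D C D.
apply: (presented_of_section (s := galg_lift word)) => [|y||i y].
- exact: Dlnk_relators_eval0.
- rewrite [RHS]galgE linear_sum; apply: eq_bigr => g _.
  apply: etrans (ncevalZ _ _ _) _; congr (_ *: _).
  apply: etrans (eq_ncevalM (eq_ncevalX _ (nceval_var _ 1))
    (eq_ncevalX _ (nceval_var _ 0))) _.
  by rewrite !geltX geltM Dlnk_codeK.
- rewrite /= (galg_lift_gelt word 1%g : galg_lift word 1 = word 1%g).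
  exact: Dlnk_word1.
- rewrite tnth_map; apply: (eqmod_galg_lift (R := ncpoly K 2)) => g.
  have [->|->] := ord2_cases i.
  + exact: (Dlnk_word_mulC l_gt0 n_gt0 kl_mod_n gT_D Cl Dn CD).
  + exact: (Dlnk_word_mulD l_gt0 n_gt0 kl_mod_n gT_D Cl Dn).
Qed.

End DlnkAlgebra.

(** * Characters *)

Definition is_char (K : fieldType) (gT : finGroupType)
    (chi : {ffun gT -> K}) : bool :=
  (chi 1%g == 1) && [forall g, forall g', chi (g * g')%g == chi g * chi g'].

Record groupChar (K : fieldType) (gT : finGroupType) := GroupChar {
  char_fun :> {ffun gT -> K};
  charP : is_char char_fun
}.

HB.instance Definition _ K gT := [isSub for @char_fun K gT].

Section GroupCharacters.
Context {K : fieldType} {gT : finGroupType}.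
Implicit Types chi : groupChar K gT.

Lemma is_char_ffun (f : gT -> K) :
    f 1%g = 1 -> (forall g g', f (g * g')%g = f g * f g') ->
  is_char [ffun g => f g].
Proof.
move=> f1 fM; rewrite /is_char ffunE f1 eqxx /=.
by apply/forallP => g; apply/forallP => g'; rewrite !ffunE fM.
Qed.

Lemma char1 chi : chi 1%g = 1.
Proof. by have /andP[/eqP] := charP chi. Qed.

Lemma charM chi g g' : chi (g * g')%g = chi g * chi g'.
Proof. by have /andP[_ /forallP/(_ g)/forallP/(_ g')/eqP] := charP chi. Qed.

Lemma charX chi g i : chi (g ^+ i)%g = chi g ^+ i.
Proof. by elim: i => [|i IH]; rewrite ?char1 // expgS exprS charM IH. Qed.

Lemma char_neq0 chi g : chi g != 0.
Proof.
apply/eqP => chi0; have := charM chi g g^-1%g; rewrite mulgV char1 chi0 mul0r.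
by move/eqP; rewrite oner_eq0.
Qed.

End GroupCharacters.

Lemma expr_gcdn_eq1 (R : pzRingType) (z : R) a b : (0 < a)%N ->
  z ^+ a = 1 -> z ^+ b = 1 -> z ^+ gcdn a b = 1.
Proof.
move=> a0 za zb; have [u _ /dvdnP[w E]] := Bezoutl b a0.
have : z ^+ (gcdn a b + u * b) = 1 by rewrite E mulnC exprM za expr1n.
by rewrite exprD mulnC exprM zb expr1n mulr1.
Qed.

Section RootsOfUnity.
Context {K : fieldType}.

Definition RootOfUnity r (z : K) (zr : r.-unity_root z) : rootsOfUnity K r :=
  exist _ z zr.

Lemma rootsOfUnityX r (z : rootsOfUnity K r) : sval z ^+ r = 1.
Proof. exact/unity_rootP/(svalP z). Qed.

Lemma rootsOfUnity_dvdX r e (z : rootsOfUnity K r) :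
  (r %| e)%N -> sval z ^+ e = 1.
Proof. by move=> /dvdnP[f ->]; rewrite mulnC exprM rootsOfUnityX expr1n. Qed.

End RootsOfUnity.

Section DlnkCharacters.
Context {K : fieldType} {k l n : nat} {gT : finGroupType} {c d : gT}.
Hypotheses (k_gt0 : (0 < k)%N) (l_gt0 : (0 < l)%N) (n_gt0 : (0 < n)%N).
Hypotheses (kl_mod_n : (k ^ l = 1 %[mod n])%N) (gT_D : is_Dlnk k l n c d).
Local Notation roots :=
  (rootsOfUnity K l * rootsOfUnity K (gcdn n (k - 1)))%type.
Implicit Types (bs : roots) (chi : groupChar K gT).

Definition Dlnk_char_fun bs g : K :=
  let: (t, i) := Dlnk_code l_gt0 n_gt0 gT_D g in
  sval bs.1 ^+ i * sval bs.2 ^+ t.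

Lemma Dlnk_char_funE bs t i :
  Dlnk_char_fun bs (d ^+ t * c ^+ i)%g = sval bs.1 ^+ i * sval bs.2 ^+ t.
Proof.
rewrite /Dlnk_char_fun Dlnk_code_nf //=.
rewrite (expr_mod _ (rootsOfUnityX _)).
by rewrite (expr_mod _ (rootsOfUnity_dvdX _ (dvdn_gcdl _ _))).
Qed.

Lemma Dlnk_char_fun1 bs : Dlnk_char_fun bs 1%g = 1.
Proof. by have := Dlnk_char_funE bs 0 0; rewrite !expg0 mulg1 !expr0 mulr1. Qed.

Lemma Dlnk_char_funM bs g g' :
  Dlnk_char_fun bs (g * g')%g = Dlnk_char_fun bs g * Dlnk_char_fun bs g'.
Proof.
have sigma_k : sval bs.2 ^+ k = sval bs.2.
  rewrite -[RHS]mul1r -(rootsOfUnity_dvdX bs.2 (dvdn_gcdr n (k - 1))) -exprSr.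
  by congr (_ ^+ _); rewrite subn1 prednK.
rewrite -(Dlnk_codeK l_gt0 n_gt0 gT_D g) -(Dlnk_codeK l_gt0 n_gt0 gT_D g').
rewrite (Dlnk_mul gT_D) !Dlnk_char_funE !exprD mulrACA; congr (_ * (_ * _)).
rewrite exprM; congr (_ ^+ _).
elim: (nat_of_ord _) => // j IH; by rewrite expnS exprM sigma_k.
Qed.

Definition Dlnk_char bs : groupChar K gT :=
  GroupChar (is_char_ffun (Dlnk_char_fun1 bs) (Dlnk_char_funM bs)).

Lemma Dlnk_charE bs t i :
  Dlnk_char bs (d ^+ t * c ^+ i)%g = sval bs.1 ^+ i * sval bs.2 ^+ t.
Proof. by rewrite ffunE Dlnk_char_funE. Qed.

Lemma Dlnk_char_c_root chi : l.-unity_root (chi c).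
Proof.
by have [_ _ cl _ _] := gT_D; apply/unity_rootP; rewrite -charX cl char1.
Qed.

Lemma Dlnk_char_d_root chi : (gcdn n (k - 1)).-unity_root (chi d).
Proof.
have [_ _ _ dn cd] := gT_D; apply/unity_rootP/expr_gcdn_eq1 => //.
  by rewrite -charX dn char1.
apply: (mulIf (char_neq0 chi d)); rewrite mul1r -exprSr subn1 prednK //.
by apply: (mulIf (char_neq0 chi c)); rewrite -charX -charM -cd charM mulrC.
Qed.

Definition Dlnk_roots chi : roots :=
  (RootOfUnity (Dlnk_char_c_root chi), RootOfUnity (Dlnk_char_d_root chi)).

Lemma Dlnk_charK : cancel Dlnk_char Dlnk_roots.
Proof.
move=> [beta sigma]; congr (_, _); apply: val_inj => /=.
  by have := Dlnk_charE (beta, sigma) 0 1; rewrite mul1g mulr1.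
by have := Dlnk_charE (beta, sigma) 1 0; rewrite mulg1 mul1r.
Qed.

Lemma Dlnk_rootsK : cancel Dlnk_roots Dlnk_char.
Proof.
move=> chi; apply/val_inj/ffunP => g.
rewrite -(Dlnk_codeK l_gt0 n_gt0 gT_D g) Dlnk_charE charM !charX.
exact: mulrC.
Qed.

End DlnkCharacters.

(** * The Taft algebra *)

Lemma poly_linP (K : fieldType) (V : lmodType K) (F G : {poly K} -> V) :
  linear F -> linear G -> (forall i, F 'X^i = G 'X^i) -> F =1 G.
Proof.
move=> Fl Gl FG p; rewrite -[p]coefK poly_def.
elim/big_rec: _ => [|i r _ IH]; last by rewrite Fl Gl IH FG.
by rewrite -(subrr 0) -scaleN1r addrC Fl Gl !scaleN1r !addNr.
Qed.

Section AlgebraEvaluation.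
Context {K : fieldType} {A : algType K} (a : A).

(* The library declares [horner_alg] linear only for the scaling of [in_alg]. *)
Definition alg_eval : {poly K} -> A := horner_alg a.

HB.instance Definition _ := GRing.RMorphism.on alg_eval.

Lemma alg_eval_is_scalable : scalable alg_eval.
Proof.
move=> b p; rewrite -mul_polyC rmorphM /= [alg_eval _%:P]horner_algC.
exact: mulr_algl.
Qed.

HB.instance Definition _ :=
  GRing.isScalable.Build K {poly K} A *:%R alg_eval alg_eval_is_scalable.

Lemma alg_evalX : alg_eval 'X = a.
Proof. exact: horner_algX. Qed.

Lemma alg_evalXn i : alg_eval 'X^i = a ^+ i.
Proof. by rewrite rmorphXn /= alg_evalX. Qed.

Lemma alg_eval_comm p : alg_eval p * a = a * alg_eval p.
Proof.
by have := congr1 alg_eval (mulrC p 'X); rewrite !rmorphM /= alg_evalX.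
Qed.

End AlgebraEvaluation.

Section Taft.
Context {K : fieldType} {m : nat} {q : K} {T : hopfAlgType K} {h x : T}.
Hypotheses (m_ge2 : (2 <= m)%N) (q_prim : m.-primitive_root q).
Hypothesis T_taft : is_taft m q h x.

Let m_gt0 : (0 < m)%N. Proof. exact: ltnW. Qed.

Let q_neq1 : q != 1.
Proof. by rewrite -[q]expr1 -(prim_order_dvd q_prim) dvdn1 gtn_eqF. Qed.

Lemma taft_h_grouplike : grouplike h.
Proof. by case: T_taft => _ []. Qed.

Lemma taft_x_skew_primitive : skew_primitive h x.
Proof. by case: T_taft => _ []. Qed.

Let comul_h : comul h = h \ox h := taft_h_grouplike.1.
Let counit_h : counit h = 1 := taft_h_grouplike.2.
Let counit_x : counit x = 0.
Proof. exact: counit_skew_primitive taft_h_grouplike taft_x_skew_primitive. Qed.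

Lemma taft_hm : h ^+ m = 1.
Proof.
have := presented_rel T_taft.1 (mem_head _ _).
rewrite (eq_ncevalB (eq_ncevalX m (nceval_var _ _)) (nceval1 _)).
exact: subr0_eq.
Qed.

Lemma taft_xm : x ^+ m = 0.
Proof.
have /(presented_rel T_taft.1) : ncvar K 1 ^+ m \in taft_relators m q.
  by rewrite !inE eqxx orbT.
by rewrite (eq_ncevalX m (nceval_var _ _)).
Qed.

Lemma taft_xh : x * h = q *: (h * x).
Proof.
have /(presented_rel T_taft.1) :
    ncvar K 1 * ncvar K 0 - q *: (ncvar K 0 * ncvar K 1) \in taft_relators m q.
  by rewrite !inE eqxx !orbT.
rewrite (eq_ncevalB (eq_ncevalM (nceval_var _ _) (nceval_var _ _))
  (eq_ncevalZ q (eq_ncevalM (nceval_var _ _) (nceval_var _ _)))).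
exact: subr0_eq.
Qed.

Lemma taft_lift (A : algType K) (h' x' : A) :
    h' ^+ m = 1 -> x' ^+ m = 0 -> x' * h' = q *: (h' * x') ->
  {f : {lrmorphism T -> A} | f h = h' & f x = x'}.
Proof.
move=> hm xm xh; pose w := [tuple h'; x'].
have [|f fE] := presented_lift T_taft.1 (w := w); last first.
  by exists f; [exact: (fE 0) | exact: (fE 1)].
move=> p; rewrite !inE => /or3P[] /eqP->.
- by rewrite (eq_ncevalB (eq_ncevalX m (nceval_var w 0)) (nceval1 w)) hm subrr.
- by rewrite (eq_ncevalX m (nceval_var w 1)).
- rewrite (eq_ncevalB (eq_ncevalM (nceval_var w 1) (nceval_var w 0))
    (eq_ncevalZ q (eq_ncevalM (nceval_var w 0) (nceval_var w 1)))).
  by apply/eqP; rewrite subr_eq0; apply/eqP.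
Qed.

Lemma taft_lrmorphism_ext (A : algType K) (f g : {lrmorphism T -> A}) :
  f h = g h -> f x = g x -> f =1 g.
Proof.
move=> fh fx; apply: (presented_lrmorphism_ext T_taft.1) => i.
by have [->|->] := ord2_cases i.
Qed.

Lemma taft_ind (P : T -> Prop) :
    (forall a u w, P u -> P w -> P (a *: u + w)) -> P 1 ->
    (forall u, P u -> P (h * u)) -> (forall u, P u -> P (x * u)) ->
  forall u, P u.
Proof.
move=> PZD P1 Ph Px; apply: (presented_ind T_taft.1) => // i u Pu.
by have [->|->] := ord2_cases i; [apply: Ph | apply: Px].
Qed.

Lemma taft_x_hX i : x * h ^+ i = q ^+ i *: (h ^+ i * x).
Proof.
elim: i => [|i IH]; first by rewrite !expr0 mulr1 mul1r scale1r.
rewrite {1}exprS mulrA taft_xh -scalerAl -(mulrA h) IH -scalerAr scalerA.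
by rewrite mulrA -!exprS.
Qed.

(* The property proved by induction quantifies over [P], which lets [h] and [x]
   act on predicates rather than on linear combinations of monomials. *)
Lemma taft_mon_ind (P : T -> Prop) :
    (forall a u w, P u -> P w -> P (a *: u + w)) ->
    (forall i s, P (h ^+ i * x ^+ s)) ->
  forall u, P u.
Proof.
move=> PZD Pmon u; move: P PZD Pmon.
move: u; apply: taft_ind => [a u w IHu IHw||u IH|u IH] P PZD Pmon.
- exact: PZD (IHu _ PZD Pmon) (IHw _ PZD Pmon).
- by have := Pmon 0%N 0%N; rewrite !expr0 mulr1.
- apply: (IH (fun u => P (h * u))) => [a v w Pv Pw|i s].
    by rewrite mulrDr -scalerAr; apply: PZD.
  by rewrite mulrA -exprS.
- have P0 : P 0.
    by have := PZD (-1) _ _ (Pmon 0 0)%N (Pmon 0 0)%N; rewrite scaleN1r addNr.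
  apply: (IH (fun u => P (x * u))) => [a v w Pv Pw|i s].
    by rewrite mulrDr -scalerAr; apply: PZD.
  rewrite mulrA taft_x_hX -scalerAl -mulrA -exprS -[_ *: _]addr0.
  exact: PZD.
Qed.

Lemma taft_scaled_xm b : (b *: x) ^+ m = 0.
Proof. by rewrite exprZn taft_xm scaler0. Qed.

Lemma taft_scaled_xh b : b *: x * h = q *: (h * (b *: x)).
Proof. by rewrite -scalerAl taft_xh -scalerAr !scalerA mulrC. Qed.

Definition taft_scale (b : K) : {lrmorphism T -> T} :=
  s2val (taft_lift taft_hm (taft_scaled_xm b) (taft_scaled_xh b)).

Lemma taft_scale_h b : taft_scale b h = h.
Proof. by rewrite /taft_scale; case: taft_lift. Qed.

Lemma taft_scale_x b : taft_scale b x = b *: x.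
Proof. by rewrite /taft_scale; case: taft_lift. Qed.

Lemma taft_scale_mon b i s :
  taft_scale b (h ^+ i * x ^+ s) = b ^+ s *: (h ^+ i * x ^+ s).
Proof.
by rewrite rmorphM !rmorphXn /= taft_scale_h taft_scale_x exprZn -scalerAr.
Qed.

Lemma taft_scale_coalg b : coalg_morph (taft_scale b).
Proof.
apply: (presented_coalg_morph T_taft.1) => i;
  have [->|->] := ord2_cases i => /=.
- by rewrite taft_scale_h comul_h tlift_tens ?taft_scale_h //; lin.
- rewrite taft_scale_x linearZ /= taft_x_skew_primitive [RHS]linearD /=.
  rewrite !tlift_tens; try by lin.
  rewrite taft_scale_h taft_scale_x (rmorph1 (taft_scale b)).
  by rewrite scalerDr tensZl tensZr.
- by rewrite taft_scale_h.
- by rewrite taft_scale_x linearZ /= counit_x mulr0.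
Qed.

Section CharacterAction.
Context {gT : finGroupType} (chi : groupChar K gT).

Lemma taft_act1 u : taft_scale (chi 1%g) u = u.
Proof.
apply: (@taft_lrmorphism_ext T (taft_scale (chi 1%g)) idfun).
  exact: taft_scale_h.
by rewrite taft_scale_x char1 scale1r.
Qed.

Lemma taft_actM g g' u :
  taft_scale (chi (g * g')%g) u = taft_scale (chi g) (taft_scale (chi g') u).
Proof.
apply: (@taft_lrmorphism_ext T _ (taft_scale (chi g) \o taft_scale (chi g'))).
  by rewrite /= !taft_scale_h.
by rewrite /= !taft_scale_x linearZ /= taft_scale_x charM scalerA mulrC.
Qed.

Definition taft_action : hopfAction gT T :=
  @HopfAction K gT T (fun g => taft_scale (chi g)) taft_act1 taft_actM
    (fun g => taft_scale_coalg (chi g)).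

End CharacterAction.

(* The upper triangular representation h |-> diag(1, q), x |-> E_12. Its upper
   left entry is the counit. *)
Definition taft_rep_h : 'M[K]_2 := diag_mx (\row_j (if j == 0 then 1 else q)).
Definition taft_rep_x : 'M[K]_2 := delta_mx 0 1.

Lemma taft_rep_hm : taft_rep_h ^+ m = 1.
Proof.
have hX i : taft_rep_h ^+ i = diag_mx (\row_j (if j == 0 then 1 else q) ^+ i).
  elim: i => [|i IH]; apply/matrixP => a b; first by rewrite expr0 !mxE.
  by rewrite exprS IH [_ * _]mulmx_diag !mxE exprS; case: (a == b).
rewrite hX; apply/matrixP => a b; rewrite !mxE.
by case: ifP => _; rewrite ?expr1n ?(prim_expr_order q_prim).
Qed.

Lemma taft_rep_xm : taft_rep_x ^+ m = 0.
Proof.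
rewrite -(subnK m_ge2) exprD expr2 [taft_rep_x * _]mul_delta_mx_0 //.
exact: mulr0.
Qed.

Lemma taft_rep_xh : taft_rep_x * taft_rep_h = q *: (taft_rep_h * taft_rep_x).
Proof.
rewrite [LHS]mul_mx_diag [_ * _]mul_diag_mx; apply/matrixP => a b.
rewrite !mxE; case: andP => [[/eqP-> /eqP->]|_]; rewrite /= ?mul0r ?mulr0 //.
by rewrite !mul1r mulr1.
Qed.

Definition taft_rep : {lrmorphism T -> 'M[K]_2} :=
  s2val (taft_lift taft_rep_hm taft_rep_xm taft_rep_xh).

Lemma taft_rep_h_val : taft_rep h = taft_rep_h.
Proof. by rewrite /taft_rep; case: taft_lift. Qed.

Lemma taft_rep_x_val : taft_rep x = taft_rep_x.
Proof. by rewrite /taft_rep; case: taft_lift. Qed.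

Definition taft_char (u : T) : K := taft_rep u 1 1.
Definition taft_der (u : T) : K := taft_rep u 0 1.

Lemma taft_char_is_scalar : scalar taft_char.
Proof. by move=> a u v; rewrite /taft_char linearP !mxE. Qed.

Lemma taft_der_is_scalar : scalar taft_der.
Proof. by move=> a u v; rewrite /taft_der linearP !mxE. Qed.

HB.instance Definition _ :=
  GRing.isLinear.Build K T K *%R taft_char taft_char_is_scalar.
HB.instance Definition _ :=
  GRing.isLinear.Build K T K *%R taft_der taft_der_is_scalar.

Lemma taft_repM u v i j :
  taft_rep (u * v) i j =
  taft_rep u i 0 * taft_rep v 0 j + taft_rep u i 1 * taft_rep v 1 j.
Proof.
rewrite rmorphM mxE big_ord_recl big_ord1.
by congr (_ + taft_rep u i _ * taft_rep v _ j); apply: val_inj.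
Qed.

Lemma taft_rep_col0 u : taft_rep u 1 0 = 0 /\ taft_rep u 0 0 = counit u.
Proof.
move: u; apply: taft_ind => [a u v [u1 u0] [v1 v0]||u [u1 u0]|u [u1 u0]].
- by rewrite linearP !mxE u1 u0 v1 v0 linearP mulr0 addr0.
- by rewrite rmorph1 !mxE counit1.
- rewrite !taft_repM taft_rep_h_val !mxE u1 u0 counitM counit_h /=.
  by rewrite !mul0r !mulr0 !addr0.
- rewrite !taft_repM taft_rep_x_val !mxE u1 u0 counitM counit_x /=.
  by rewrite !mul0r !mulr0 !addr0.
Qed.

Lemma taft_charM u v : taft_char (u * v) = taft_char u * taft_char v.
Proof. by rewrite /taft_char taft_repM (taft_rep_col0 u).1 mul0r add0r. Qed.

Lemma taft_char1 : taft_char 1 = 1.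
Proof. by rewrite /taft_char rmorph1 !mxE. Qed.

Lemma taft_char_h : taft_char h = q.
Proof. by rewrite /taft_char taft_rep_h_val !mxE. Qed.

Lemma taft_char_x : taft_char x = 0.
Proof. by rewrite /taft_char taft_rep_x_val !mxE. Qed.

Lemma taft_derM u v :
  taft_der (u * v) = counit u * taft_der v + taft_der u * taft_char v.
Proof. by rewrite /taft_der taft_repM (taft_rep_col0 u).2. Qed.

Lemma taft_der1 : taft_der 1 = 0.
Proof. by rewrite /taft_der rmorph1 !mxE. Qed.

Lemma taft_der_h : taft_der h = 0.
Proof. by rewrite /taft_der taft_rep_h_val !mxE. Qed.

Lemma taft_der_x : taft_der x = 1.
Proof. by rewrite /taft_der taft_rep_x_val !mxE. Qed.

(* N is diagonal on the monomials and D is the q-derivation killing [h] and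
   mapping [x] to [h]. *)
Local Notation N := (hit taft_char).
Local Notation D := (hit taft_der).

Lemma hit_charM u v : N (u * v) = N u * N v.
Proof. exact: hitM taft_charM. Qed.

Lemma hit_derM u v : D (u * v) = u * D v + D u * N v.
Proof. exact: hit_skew_derivation taft_derM. Qed.

Lemma hit_char_h : N h = q *: h.
Proof. by rewrite (hit_grouplike _ taft_h_grouplike) /= taft_char_h. Qed.

Lemma hit_der_h : D h = 0.
Proof. by rewrite (hit_grouplike _ taft_h_grouplike) /= taft_der_h scale0r. Qed.

Lemma hit_char_x : N x = x.
Proof.
rewrite (hit_skew_primitive _ taft_x_skew_primitive) /= taft_char_x taft_char1.
by rewrite scale0r add0r scale1r.
Qed.

Lemma hit_der_x : D x = h.
Proof.
rewrite (hit_skew_primitive _ taft_x_skew_primitive) /= taft_der_x taft_der1.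
by rewrite scale0r addr0 scale1r.
Qed.

Lemma hit_char_hX i : N (h ^+ i) = q ^+ i *: h ^+ i.
Proof.
elim: i => [|i IH]; first by rewrite expr0 hit1 /= taft_char1.
by rewrite exprS hit_charM IH hit_char_h -scalerAl -scalerAr scalerA -(exprS q).
Qed.

Lemma hit_char_xX s : N (x ^+ s) = x ^+ s.
Proof.
elim: s => [|s IH]; first by rewrite expr0 hit1 /= taft_char1 scale1r.
by rewrite exprS hit_charM IH hit_char_x.
Qed.

Lemma hit_der_hXM i u : D (h ^+ i * u) = h ^+ i * D u.
Proof.
elim: i => [|i IH]; first by rewrite expr0 !mul1r.
by rewrite exprS -mulrA hit_derM IH hit_der_h mul0r addr0 mulrA.
Qed.

Definition qnum s : K := \sum_(j < s) q ^+ j.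

Lemma qnum_neq0 s : (0 < s < m)%N -> qnum s != 0.
Proof.
case/andP=> s0 sm; apply/eqP=> qs.
have := subrX1 q s; rewrite -/(qnum s) qs mulr0 => /eqP.
by rewrite subr_eq0 -(prim_order_dvd q_prim) gtnNdvd.
Qed.

Lemma hit_der_xX s : D (x ^+ s.+1) = qnum s.+1 *: (h * x ^+ s).
Proof.
elim: s => [|s IH].
  by rewrite expr1 hit_der_x /qnum big_ord1 expr0 mulr1 scale1r.
rewrite exprS hit_derM IH hit_der_x hit_char_xX -scalerAr mulrA taft_xh.
rewrite -scalerAl -mulrA -exprS scalerA -[X in _ + X]scale1r -scalerDl.
congr (_ *: _).
rewrite /qnum [RHS]big_ord_recl expr0 addrC; congr (_ + _).
by rewrite mulr_suml; apply: eq_bigr => j _; rewrite -exprSr.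
Qed.

Lemma hit_char_mon i s : N (h ^+ i * x ^+ s) = q ^+ i *: (h ^+ i * x ^+ s).
Proof. by rewrite hit_charM hit_char_hX hit_char_xX scalerAl. Qed.

Lemma hit_der_mon i s :
  D (h ^+ i * x ^+ s.+1) = qnum s.+1 *: (h ^+ i.+1 * x ^+ s).
Proof. by rewrite hit_der_hXM hit_der_xX -scalerAr mulrA -exprSr. Qed.

Lemma hit_char_der u : N (D u) = q *: D (N u).
Proof.
move: u; apply: taft_mon_ind => [a u v IHu IHv|i [|s]].
- by rewrite !linearP /= IHu IHv.
- rewrite hit_char_mon linearZ /= hit_der_hXM expr0 hit1 /= taft_der1.
  by rewrite scale0r mulr0 linear0 !scaler0.
- rewrite hit_char_mon hit_der_mon !linearZ /= hit_char_mon hit_der_mon.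
  by rewrite !scalerA mulrC -exprSr.
Qed.

Local Notation eval_h := (alg_eval h).

Lemma hit_char_eval p : N (eval_h p) = eval_h (p \Po (q *: 'X)).
Proof.
move: p; apply: poly_linP => [||i]; [by lin | by lin |].
by rewrite comp_Xn_poly exprZn linearZ /= alg_evalXn hit_char_hX.
Qed.

Lemma hit_der_evalM p u : D (eval_h p * u) = eval_h p * D u.
Proof.
move: p; apply: poly_linP => [||i]; [by lin | by lin |].
by rewrite alg_evalXn hit_der_hXM.
Qed.

Lemma counit_eval p : counit (eval_h p) = p.[1].
Proof.
move: p; apply: (@poly_linP K K^o) => [|a p r|i]; [by lin | |].
  by rewrite hornerD hornerZ.
by rewrite alg_evalXn counitX counit_h hornerXn !expr1n.
Qed.

Lemma eval_h_cocommutes p : cocommutes (eval_h p).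
Proof.
move: p; apply: poly_linP => [||i]; [by lin | by lin |].
by rewrite alg_evalXn (grouplikeX i taft_h_grouplike).1 tlift_tens //; lin.
Qed.

Lemma eval_h_eq0 p : (forall i, p.[q ^+ i] = 0) -> eval_h p = 0.
Proof.
move=> p0; have /dvdpP[r ->] : 'X^m - 1 %| p.
  rewrite -(factor_Xn_sub_1 q_prim) -(big_map (fun i => q ^+ i) xpredT
    (fun z => 'X - z%:P)); apply: uniq_roots_dvdp.
    by apply/allP => _ /mapP[i _ ->]; apply/rootP.
  rewrite uniq_rootsE map_inj_in_uniq ?iota_uniq // => i j.
  rewrite !mem_index_iota /= => im jm /eqP.
  by rewrite (eq_prim_root_expr q_prim) !modn_small // => /eqP.
by rewrite rmorphM rmorphB /= alg_evalXn taft_hm rmorph1 subrr mulr0.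
Qed.

Lemma taft_expand u :
  exists p : nat -> {poly K}, u = \sum_(s < m) eval_h (p s) * x ^+ s.
Proof.
move: u; apply: taft_mon_ind => [a u w [p ->] [p' ->]|i s].
  exists (fun s => a *: p s + p' s); rewrite scaler_sumr -big_split.
  by apply: eq_bigr => s _; rewrite linearP mulrDl scalerAl.
exists (fun s' => if s' == s then 'X^i else 0).
case: (ltnP s m) => sm; last first.
  rewrite -(subnK sm) exprD taft_xm !mulr0 big1 // => s' _.
  by rewrite subnK // (ltn_eqF (leq_trans (ltn_ord s') sm)) linear0 mul0r.
rewrite (bigD1 (Ordinal sm)) //= eqxx alg_evalXn big1 ?addr0 //.
move=> s' /negPf ss'.
by rewrite -[s' == s :> nat]/(s' == Ordinal sm) ss' linear0 mul0r.
Qed.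

Lemma hit_der_expand r (p : nat -> {poly K}) :
  D (\sum_(s < r.+1) eval_h (p s) * x ^+ s) =
  \sum_(s < r) eval_h (qnum s.+1 *: (p s.+1 * 'X)) * x ^+ s.
Proof.
rewrite big_ord_recl linearD linear_sum /= hit_der_evalM expr0 hit1 /=.
rewrite taft_der1 scale0r mulr0 add0r; apply: eq_bigr => s _.
rewrite hit_der_evalM hit_der_xX -scalerAr mulrA linearZ rmorphM /= alg_evalX.
by rewrite scalerAl.
Qed.

Lemma hit_der_expand_eq0 r (p : nat -> {poly K}) : (r < m)%N ->
    D (\sum_(s < r.+1) eval_h (p s) * x ^+ s) = 0 ->
  forall s, (s < r)%N -> eval_h (p s.+1) = 0.
Proof.
elim: r p => // r IH p rm; rewrite hit_der_expand => D0.
pose p' s := qnum s.+1 *: (p s.+1 * 'X).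
have p'0 s : (s < r.+1)%N -> eval_h (p' s) = 0 -> eval_h (p s.+1) = 0.
  move=> sr /eqP; rewrite linearZ rmorphM /= alg_evalX scaler_eq0.
  rewrite (negPf (qnum_neq0 _)) /=; last exact: leq_ltn_trans rm.
  move=> /eqP ph0; rewrite -[LHS]mulr1 -taft_hm -(prednK m_gt0) exprS mulrA ph0.
  exact: mul0r.
have p'S s : (s < r)%N -> eval_h (p' s.+1) = 0.
  by apply: (IH p'); [exact: ltnW | rewrite D0 linear0].
move=> [|s] sr; apply: p'0 => //; last exact: p'S.
rewrite -[RHS]D0 big_ord_recl expr0 mulr1 big1 ?addr0 // => s _.
by rewrite p'S ?mul0r.
Qed.

Lemma ker_hit_der u : D u = 0 -> exists p, u = eval_h p.
Proof.
have [p ->] := taft_expand u; rewrite -(prednK m_gt0) => D0; exists (p 0%N).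
have {D0} p0 := hit_der_expand_eq0 _ D0.
rewrite big_ord_recl expr0 mulr1 big1 ?addr0 // => s _.
by rewrite p0 ?mul0r // prednK.
Qed.

Lemma hit_eigen u j : D u = 0 -> N u = q ^+ j *: u -> u = counit u *: h ^+ j.
Proof.
move=> /ker_hit_der[p ->{u}] Np; rewrite counit_eval.
have iter_N i r : iter i N (eval_h r) = eval_h (r \Po (q ^+ i *: 'X)).
  elim: i r => [|i IH] r; first by rewrite scale1r comp_polyXr.
  rewrite iterSr hit_char_eval IH -comp_polyA comp_polyZ comp_polyX scalerA.
  by rewrite exprS.
have iter_p i : iter i N (eval_h p) = (q ^+ j) ^+ i *: eval_h p.
  elim: i => [|i IH]; first by rewrite scale1r.
  by rewrite iterS IH linearZ /= Np scalerA exprSr.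
apply: subr0_eq; rewrite -alg_evalXn -linearZ -linearB.
apply: eval_h_eq0 => i.
have /(congr1 counit) := iter_p i; rewrite iter_N linearZ /= !counit_eval.
rewrite horner_comp !hornerE => ->.
by rewrite -!exprM mulnC mulrC subrr.
Qed.

Lemma taft_der_grouplike u : grouplike u -> taft_der u = 0.
Proof.
move=> gu; have [cu eu] := gu; have char_u : taft_char u != 0.
  have := antipodel u; rewrite cu tlift_tens; try by lin.
  rewrite eu scale1r => /(congr1 taft_char).
  rewrite taft_charM taft_char1 => Su.
  by apply/eqP => u0; move/eqP: Su; rewrite u0 mulr0 eq_sym oner_eq0.
have /(congr1 counit)/eqP := hit_char_der u.
rewrite !(hit_grouplike _ gu) !linearZ /= !(hit_grouplike _ gu) !linearZ /=.
rewrite eu !mulr1 mulrC -subr_eq0 -{1}[taft_char u]mul1r -mulrA -mulrBl.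
rewrite mulf_eq0 subr_eq0 eq_sym (negPf q_neq1) mulf_eq0 (negPf char_u).
by move/eqP.
Qed.

Lemma taft_skew_primitive_grouplike u y :
  grouplike u -> skew_primitive u y -> taft_der y != 0 -> u = h.
Proof.
move=> gu cy der_y; have Du : D u = 0.
  by rewrite (hit_grouplike _ gu) /= taft_der_grouplike ?scale0r.
have Nu : N u = q ^+ 1 *: u.
  apply: (scalerI der_y); have := hit_char_der y.
  rewrite !(hit_skew_primitive _ cy) /= taft_der1 taft_char1 scale0r scale1r.
  rewrite addr0 linearD !linearZ /= Du scaler0 add0r.
  rewrite (hit_skew_primitive _ cy) /= => ->.
  by rewrite taft_der1 scale0r addr0 !scalerA mulrC.
by rewrite (hit_eigen Du Nu) gu.2 scale1r.
Qed.

Lemma taft_x_not_cocommutes : ~ cocommutes x.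
Proof.
rewrite /cocommutes taft_x_skew_primitive linearD /= !tlift_tens; try by lin.
move/(congr1 (tlift (fun a b => taft_der a *: b))).
rewrite !linearD /= !tlift_tens; try by lin.
rewrite taft_der_h taft_der_x taft_der1 !scale0r add0r addr0 !scale1r => h1.
by move/eqP: q_neq1; apply; rewrite -taft_char_h -h1 taft_char1.
Qed.

Section MatchedPairCharacter.
Context {gT : finGroupType} (mp : matchedPair T (groupAlg K gT)).
Local Notation KG := (groupAlg K gT).
Local Notation lact g a := (gelt g |>[mp] a).
Local Notation ract g a := (gelt g <|[mp] a).

Lemma taft_mp_lact_x_skew_primitive g : skew_primitive (lact g h) (lact g x).
Proof.
apply: (skew_primitive_map (mp_lact_gelt_coalg mp g)); last first.
  exact: taft_x_skew_primitive.
exact: mp_lact_gelt1.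
Qed.

(* Otherwise [lact g x] would lie in the cocommutative subalgebra K[h], and so
   would [x]. *)
Lemma taft_der_lact_x g : taft_der (lact g x) != 0.
Proof.
apply/eqP => der0; apply: taft_x_not_cocommutes.
have [|p yE] := @ker_hit_der (lact g x).
  rewrite (hit_skew_primitive _ (taft_mp_lact_x_skew_primitive g)) /= der0.
  by rewrite taft_der1 !scale0r addr0.
rewrite -(mp_lact_geltK mp g x) yE.
exact: cocommutes_map (mp_lact_gelt_coalg mp g^-1%g) (eval_h_cocommutes p).
Qed.

Lemma taft_mp_lact_h g : lact g h = h.
Proof.
apply: (taft_skew_primitive_grouplike _ (taft_mp_lact_x_skew_primitive g)).
  exact: grouplike_map (mp_lact_gelt_coalg mp g) taft_h_grouplike.
exact: taft_der_lact_x.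
Qed.

Lemma taft_mp_ract_h_x g : ract g h = gelt g /\ ract g x = 0.
Proof.
have [ract1 _ _ _] := mp_rmodcoalg mp.
have := mp_swap_gelt mp g x; rewrite taft_x_skew_primitive !linearD /=.
rewrite !tlift_tens; try by lin.
rewrite ract1 mp_lact_gelt1 taft_mp_lact_h => swap.
have pairing (f : {scalar T}) : f h *: ract g x + f (lact g x) *: gelt g =
    f (lact g x) *: ract g h + f 1 *: ract g x.
  move/(congr1 (tlift (fun (a : KG) b => f b *: a))): swap.
  by rewrite !linearD /= !tlift_tens //; lin.
have ract_h : ract g h = gelt g.
  have := pairing taft_der;
    rewrite /= taft_der_h taft_der1 !scale0r add0r addr0.
  by move/(scalerI (taft_der_lact_x g)).
split=> //; have := pairing taft_char.
rewrite ract_h /= taft_char_h taft_char1 addrC => /addrI/eqP.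
rewrite -subr_eq0 -scalerBl scaler_eq0 subr_eq0 (negPf q_neq1).
by move/eqP.
Qed.

Lemma taft_mp_ractE g a : ract g a = counit a *: gelt g.
Proof.
have [ract_h ract_x] := taft_mp_ract_h_x g.
have [ract1 ractM _ _] := mp_rmodcoalg mp.
move: a; apply: taft_ind => [b u v IHu IHv||u IH|u IH].
- by rewrite tensDr tensZr !linearP /= IHu IHv scalerDl scalerA.
- by rewrite ract1 counit1 scale1r.
- by rewrite ractM ract_h IH counitM counit_h mul1r.
- by rewrite ractM ract_x counitM counit_x mul0r scale0r tens0l linear0.
Qed.

Lemma taft_mp_lact_mul g a b : lact g (a * b) = lact g a * lact g b.
Proof. exact/mp_lact_gelt_mul/taft_mp_ractE. Qed.

Lemma taft_mp_lact_x g : lact g x = taft_der (lact g x) *: x.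
Proof.
set b := taft_der _; pose w := lact g x - b *: x.
have [|p wE] := @ker_hit_der w.
  rewrite linearB linearZ /= hit_der_x.
  rewrite (hit_skew_primitive _ (taft_mp_lact_x_skew_primitive g)) /= taft_der1.
  by rewrite scale0r addr0 taft_mp_lact_h subrr.
have wh : w * h = q *: (h * w).
  have yh : lact g x * h = q *: (h * lact g x).
    rewrite -{1 2}(taft_mp_lact_h g) -!taft_mp_lact_mul taft_xh tensZr.
    by rewrite linearZ.
  rewrite mulrBl mulrBr scalerBr yh -scalerAl -scalerAr taft_xh !scalerA.
  by rewrite mulrC.
have hw : h * w = 0.
  move/eqP: wh; rewrite [in w * h]wE alg_eval_comm -wE -subr_eq0.
  rewrite -{1}[h * w]scale1r -scalerBl scaler_eq0 subr_eq0 eq_sym.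
  by rewrite (negPf q_neq1) => /eqP.
apply: subr0_eq; rewrite -/w -[w]mul1r -taft_hm -(prednK m_gt0) exprSr.
by rewrite -mulrA hw mulr0.
Qed.

Lemma taft_mp_lactE g a : lact g a = taft_scale (taft_der (lact g x)) a.
Proof.
move: a; apply: taft_ind => [b u v IHu IHv||u IH|u IH].
- by rewrite tensDr tensZr !linearP /= IHu IHv.
- by rewrite mp_lact_gelt1 rmorph1.
- by rewrite taft_mp_lact_mul taft_mp_lact_h IH rmorphM /= taft_scale_h.
- by rewrite taft_mp_lact_mul IH {1}taft_mp_lact_x rmorphM /= taft_scale_x.
Qed.

Lemma taft_mp_char_fun1 : taft_der (lact 1%g x) = 1.
Proof. by have [-> _ _ _] := mp_lmodcoalg mp; apply: taft_der_x. Qed.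

Lemma taft_mp_char_funM g g' :
  taft_der (lact (g * g')%g x) = taft_der (lact g x) * taft_der (lact g' x).
Proof.
have [_ lactM _ _] := mp_lmodcoalg mp.
rewrite -geltM lactM (taft_mp_lact_x g') tensZr linearZ /= (taft_mp_lact_x g).
by rewrite !linearZ /= taft_der_x !mulr1 mulrC.
Qed.

Definition taft_mp_char : groupChar K gT :=
  GroupChar (is_char_ffun taft_mp_char_fun1 taft_mp_char_funM).

End MatchedPairCharacter.

Section TaftMatchedPair.
Context {gT : finGroupType}.

Definition taft_matchedPair (chi : groupChar K gT) :
    matchedPair T (groupAlg K gT) :=
  act_matchedPair (taft_action chi).

Lemma taft_matchedPair_lact chi g a :
  gelt g |>[taft_matchedPair chi] a = taft_scale (chi g) a.
Proof. exact: act_lact_gelt. Qed.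

Lemma taft_matchedPair_ract chi y a :
  y <|[taft_matchedPair chi] a = counit a *: y.
Proof. exact: act_ractE. Qed.

Lemma taft_mp_charK : cancel taft_mp_char taft_matchedPair.
Proof.
move=> mp; apply: matchedPair_eq => g a.
  by rewrite taft_matchedPair_lact taft_mp_lactE ffunE.
by rewrite taft_matchedPair_ract taft_mp_ractE.
Qed.

Lemma taft_matchedPairK : cancel taft_matchedPair taft_mp_char.
Proof.
move=> chi; apply/val_inj/ffunP => g; rewrite ffunE taft_matchedPair_lact.
by rewrite taft_scale_x linearZ /= taft_der_x mulr1.
Qed.

End TaftMatchedPair.

End Taft.

(** * The Hopf algebras [T_{lnm^2}^{beta,sigma}(q)] *)

Section TaftSkewAlgebra.
Context {K : fieldType} {m : nat} {q : K} {k l n : nat}.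
Context {T : hopfAlgType K} {h x : T} {gT : finGroupType} {c d : gT}.
Hypotheses (m_gt0 : (0 < m)%N) (l_gt0 : (0 < l)%N) (n_gt0 : (0 < n)%N).
Hypothesis kl_mod_n : (k ^ l = 1 %[mod n])%N.
Hypotheses (T_taft : is_taft m q h x) (gT_D : is_Dlnk k l n c d).
Variable chi : groupChar K gT.
Local Notation B := (skewGroupAlg (taft_action T_taft chi)).

Let cB : B := single c 1.
Let dB : B := single d 1.
Let hB : B := single 1%g h.
Let xB : B := single 1%g x.

Definition taft_cross (i j : 'I_2) : freeAlg K 2 :=
  if j == 0 then ncvar K 0 else chi (tnth [tuple c; d] i) *: ncvar K 1.

Lemma nceval_taft_cross i j : nceval [tuple h; x] (taft_cross i j) =
  taft_action T_taft chi (tnth [tuple c; d] i) (tnth [tuple h; x] j).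
Proof.
rewrite /taft_cross; have [->|->] := ord2_cases j => /=.
  by rewrite nceval_var; apply/esym/taft_scale_h.
rewrite (eq_ncevalZ _ (nceval_var _ _)); exact/esym/taft_scale_x.
Qed.

Lemma skew_relatorsE :
  skew_relators (Dlnk_relators K k l n) (taft_relators m q) taft_cross =
  let C : ncpoly K 4 := ncvar K 0 in let D : ncpoly K 4 := ncvar K 1 in
  let H : ncpoly K 4 := ncvar K 2 in let X : ncpoly K 4 := ncvar K 3 in
  [:: C ^+ l - 1; D ^+ n - 1; C * D - D ^+ k * C;
      H ^+ m - 1; X ^+ m; X * H - q *: (H * X);
      C * H - H * C; C * X - chi c *: (X * C);
      D * H - H * D; D * X - chi d *: (X * D)].
Proof.
have inG0 : nc_rename (lshift 2) (ncvar K (0 : 'I_2)) = ncvar K (0 : 'I_4).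
  by rewrite nc_rename_var; congr ncvar; apply: val_inj.
have inG1 : nc_rename (lshift 2) (ncvar K (1 : 'I_2)) = ncvar K (1 : 'I_4).
  by rewrite nc_rename_var; congr ncvar; apply: val_inj.
have inT0 : nc_rename (@rshift 2 2) (ncvar K (0 : 'I_2)) = ncvar K (2 : 'I_4).
  by rewrite nc_rename_var; congr ncvar; apply: val_inj.
have inT1 : nc_rename (@rshift 2 2) (ncvar K (1 : 'I_2)) = ncvar K (3 : 'I_4).
  by rewrite nc_rename_var; congr ncvar; apply: val_inj.
have enum2 : enum 'I_2 = [:: 0; 1].
  by rewrite !enum_ordSl enum_ord0 /=; congr [:: _; _]; apply: val_inj.
have inTx (b : K) : nc_rename (@rshift 2 2) (b *: ncvar K 1) = b *: ncvar K 3.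
  exact: eq_ncevalZ inT1.
have eq_cross (a a' b b' e e' : ncpoly K 4) :
    a = a' -> b = b' -> e = e' -> a * b - e * a = a' * b' - e' * a'.
  by move=> -> -> ->.
have eq_crossZ (a a' b b' e : ncpoly K 4) (s : K) :
    a = a' -> b = b' -> e = s *: b' ->
  a * b - e * a = a' * b' - s *: (b' * a').
  by move=> -> -> ->; rewrite scalerAl.
rewrite /skew_relators enum2 /= /taft_cross /=.
apply: (congr2 cons (eq_ncevalB (eq_ncevalX l inG0) (nceval1 _))).
apply: (congr2 cons (eq_ncevalB (eq_ncevalX n inG1) (nceval1 _))).
apply: (congr2 cons (eq_ncevalB (eq_ncevalM inG0 inG1)
  (eq_ncevalM (eq_ncevalX k inG1) inG0))).
apply: (congr2 cons (eq_ncevalB (eq_ncevalX m inT0) (nceval1 _))).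
apply: (congr2 cons (eq_ncevalX m inT1)).
apply: (congr2 cons (eq_ncevalB (eq_ncevalM inT1 inT0)
  (eq_ncevalZ q (eq_ncevalM inT0 inT1)))).
apply: (congr2 cons (eq_cross _ _ _ _ _ _ inG0 inT0 inT0)).
apply: (congr2 cons (eq_crossZ _ _ _ _ _ _ inG0 inT1 (inTx _))).
apply: (congr2 cons (eq_cross _ _ _ _ _ _ inG1 inT0 inT0)).
exact: (congr2 cons (eq_crossZ _ _ _ _ _ _ inG1 inT1 (inTx _)) erefl).
Qed.

Lemma skew_relators_Tbs :
  skew_relators (Dlnk_relators K k l n) (taft_relators m q) taft_cross =i
  Tbs_relators m q k l n (chi c) (chi d).
Proof.
rewrite skew_relatorsE; set s := (X in X =i _).
have -> : Tbs_relators m q k l n (chi c) (chi d) =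
    [seq nth 0 s i | i <- [:: 0; 1; 3; 4; 6; 8; 2; 7; 9; 5]%N].
  by [].
apply: perm_mem; rewrite -[s in perm_eq s](mkseq_nth 0).
exact: perm_map.
Qed.

Lemma Tbs_presented :
  is_presented [tuple cB; dB; hB; xB] (Tbs_relators m q k l n (chi c) (chi d)).
Proof.
have -> : [tuple cB; dB; hB; xB] = skew_gens [tuple c; d] [tuple h; x].
  exact: val_inj.
apply: (eq_presented skew_relators_Tbs); apply: skew_presented.
- exact: Dlnk_galg_presented.
- exact: T_taft.1.
- exact: nceval_taft_cross.
Qed.

Lemma single_eltX g i : (single g 1 : B) ^+ i = single (g ^+ i)%g 1.
Proof. by rewrite -!galg_single_gelt -geltX rmorphXn. Qed.

Lemma taft_skew_is_Tbs : is_Tbs m q k l n (chi c) (chi d) cB dB hB xB.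
Proof.
have [_ _ cl dn _] := gT_D.
have elt_grouplike g : grouplike (single g 1 : B).
  split; last by rewrite [LHS]skew_counit_single counit1.
  by rewrite [LHS]skew_comul_single comul1 tlift_tens //; lin.
have hB_grouplike : grouplike hB.
  exact: grouplike_map single1_coalg_morph (taft_h_grouplike T_taft).
have xB_skew : skew_primitive hB xB.
  exact: skew_primitive_map single1_coalg_morph _
    (taft_x_skew_primitive T_taft).
have hBm : hB * hB ^+ (m - 1) = 1.
  by rewrite -exprS subn1 prednK // -rmorphXn /= (taft_hm T_taft).
have eltV g e : (0 < e)%N -> (g ^+ e)%g = 1%g ->
    (single g 1 : B) * single g 1 ^+ (e - 1) = 1.
  by move=> e0 ge; rewrite -exprS subn1 prednK // single_eltX ge.
split; first exact: Tbs_presented.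
- by split; [exact: (elt_grouplike c).1 | exact: (elt_grouplike d).1
    | exact: hB_grouplike.1 | exact: xB_skew].
- split; [exact: (elt_grouplike c).2 | exact: (elt_grouplike d).2
    | exact: hB_grouplike.2 | exact: counit_skew_primitive xB_skew].
- split;
    [exact: antipode_grouplike hBm | exact: antipode_skew_primitive hBm | |].
  + exact: antipode_grouplike (elt_grouplike c) (eltV c l l_gt0 cl).
  + exact: antipode_grouplike (elt_grouplike d) (eltV d n n_gt0 dn).
Qed.

End TaftSkewAlgebra.

Theorem theorem2p2 (K : fieldType) (m : nat) (q : K) (k l n : nat)
    (T : hopfAlgType K) (h x : T) (gT : finGroupType) (c d : gT)
    (m_ge2 : (2 <= m)%N) (q_prim : m.-primitive_root q)
    (k_gt0 : (0 < k)%N) (l_gt0 : (0 < l)%N) (n_gt0 : (0 < n)%N)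
    (kl_mod_n : (k ^ l = 1 %[mod n])%N)
    (T_taft : is_taft m q h x) (gT_D : is_Dlnk k l n c d) :
  (exists F : rootsOfUnity K l * rootsOfUnity K (gcdn n (k - 1)) ->
              matchedPair T (groupAlg K gT),
     bijective F /\
     forall (beta : rootsOfUnity K l)
            (sigma : rootsOfUnity K (gcdn n (k - 1))) (t i j' j : nat),
       (t < n)%N -> (i < l)%N -> (j' < m)%N -> (j < m)%N ->
       let g : groupAlg K gT := gelt (d ^+ t * c ^+ i)%g in
       let a : T := h ^+ j' * x ^+ j in
       g |>[F (beta, sigma)] a
         = (sval beta ^+ (i * j) * sval sigma ^+ (t * j)) *: a
       /\ g <|[F (beta, sigma)] a = counit a *: g)
  /\
  (forall mp : matchedPair T (groupAlg K gT),
     exists (beta : rootsOfUnity K l)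
            (sigma : rootsOfUnity K (gcdn n (k - 1)))
            (B : hopfAlgType K) (cB dB hB xB : B),
       is_Tbs m q k l n (sval beta) (sval sigma) cB dB hB xB /\
       hopf_isomorphic (bicrossed mp) (hopf_data B)).
Proof.
pose bs_char := Dlnk_char (K := K) k_gt0 l_gt0 n_gt0 kl_mod_n gT_D.
pose bs_roots := Dlnk_roots (K := K) k_gt0 n_gt0 gT_D.
split.
- exists (taft_matchedPair T_taft \o bs_char); split.
    apply: bij_comp; last first.
      by exists bs_roots; [exact: Dlnk_charK | exact: Dlnk_rootsK].
    exists (taft_mp_char m_ge2 q_prim T_taft).
      exact: taft_matchedPairK.
    exact: taft_mp_charK.
  move=> beta sigma t i j' j _ _ _ _ g a.
  split; last exact: taft_matchedPair_ract.
  by rewrite taft_matchedPair_lact Dlnk_charE taft_scale_mon exprMn -!exprM.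
- move=> mp; rewrite -(taft_mp_charK m_ge2 q_prim T_taft mp).
  set chi := taft_mp_char _ _ _ mp.
  exists (bs_roots chi).1, (bs_roots chi).2,
    (skewGroupAlg (taft_action T_taft chi)).
  exists (single c 1), (single d 1), (single 1%g h), (single 1%g x); split.
    exact: (taft_skew_is_Tbs (ltnW m_ge2) l_gt0 n_gt0 kl_mod_n T_taft gT_D).
  exact: bicrossed_skew_isomorphic.
Qed.
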